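(* Let $N\ge 2$, $s\in(0,1)$, let $\Omega\subset\mathbb{R}^N$ be a smooth bounded domain and let $q>\frac{N}{2s}$. Let $g_0,V_0\in L^q(\Omega)$ satisfy $g_0^+\not\equiv 0$ and $\|V_0^-\|_q\le \frac{\frac{C_{N,s}}{2}-\delta}{C^2}$ for some $\delta\in\left(0,\frac{C_{N,s}}{2}\right)$. Let $\underline{g}\in\mathcal{E}(g_0)$ and $\underline{V}\in\mathcal{E}(V_0)$ be minimizers, i.e. $$\lambda_1(\underline{g},\underline{V})=\min\{\lambda_1(g,V): g\in\mathcal{E}(g_0),\ V\in\mathcal{E}(V_0)\},$$ and let $u$ be a positive first eigenfunction associated to $\underline{g}$ and $\underline{V}$. Then: (i) there exists an increasing function $\phi:\mathbb{R}\to\mathbb{R}$ such that $\underline{g}=\phi\circ u$ a.e. in $\Omega$; (ii) there exists a decreasing function $\psi:\mathbb{R}\to\mathbb{R}$ such that $\underline{V}=\psi\circ u$ a.e. in $\Omega$.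
   Context: ''Increasing'' and ''decreasing'' are meant in the non-strict sense. $C_{N,s}>0$ is the normalization constant of the fractional Laplacian $(-\Delta)^s u(x)=C_{N,s}\,\mathrm{P.V.}\int_{\mathbb{R}^N}\frac{u(x)-u(y)}{|x-y|^{N+2s}}\,dy$, i.e. $C_{N,s}=\left(\int_{\mathbb{R}^N}\frac{1-\cos\zeta_1}{|\zeta|^{N+2s}}d\zeta\right)^{-1}$. $[u]_s=\left(\int_{\mathbb{R}^N}\int_{\mathbb{R}^N}\frac{|u(x)-u(y)|^2}{|x-y|^{N+2s}}\,dx\,dy\right)^{1/2}$; $H_0^s(\Omega)=\{u\in L^2(\mathbb{R}^N):[u]_s<\infty,\ u=0 \text{ in } \mathbb{R}^N\setminus\Omega\}$. With $q'=\frac{q}{q-1}$, $C$ is the best constant of the embedding $H_0^s(\Omega)\hookrightarrow L^{2q'}(\Omega)$, i.e. the smallest constant with $\|u\|_{L^{2q'}(\Omega)}\le C[u]_s$ for all $u\in H^s_0(\Omega)$. Also $h^+=\max\{h,0\}$, $h^-=\max\{-h,0\}$. $$\lambda_1(g,V)=\inf\left\{\frac{\frac{C_{N,s}}{2}[u]_s^2+\int_\Omega V|u|^2dx}{\int_\Omega g|u|^2dx}: u\in H_0^s(\Omega),\ \int_\Omega g|u|^2dx>0\right\}.$$ A first eigenfunction associated to $(g,V)$ is a function $u\in H_0^s(\Omega)$ at which this infimum is attained. For a measurable $\phi:\Omega\to\mathbb{R}$, $\mathcal{E}(\phi)$ is the set of all measurable $\psi:\Omega\to\mathbb{R}$ with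 $|\{\psi>t\}|=|\{\phi>t\}|$ for all $t\in\mathbb{R}$ ($|\cdot|$ = Lebesgue measure).
   Formalization: The functions φ and ψ may take the values ±∞; φ (resp. ψ) is real-valued on all of R when g_0 (resp. V_0) is in L^∞(Ω). As u is bounded, a monotone φ: R→R would force g_0 to be essentially bounded, so the literal claim fails for unbounded g_0 or V_0. *)

(* Defs.v *)
From HB Require Import structures.
From mathcomp Require Import all_boot all_order all_algebra.
From mathcomp Require Import all_classical all_reals all_analysis.

Set Implicit Arguments.
Unset Strict Implicit.
Unset Printing Implicit Defensive.
Import Order.TTheory GRing.Theory Num.Theory.
Import numFieldNormedType.Exports.

Local Open Scope classical_set_scope.
Local Open Scope ring_scope.

(* Same construction as the library's sigma-algebra on n.-tuple T: the one
   generated by the coordinate maps. For T = R it is the Borel sigma-algebra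
   of R^n. *)
Section measurable_rV.
Context {d} {T : measurableType d} (n : nat).

Let coors : 'I_n -> 'rV[T]_n -> T := fun i v => v ord0 i.

Let rV_set0 : g_sigma_preimage coors set0.
Proof. exact: sigma_algebra0. Qed.

Let rV_setC A : g_sigma_preimage coors A -> g_sigma_preimage coors (~` A).
Proof. exact: sigma_algebraC. Qed.

Let rV_bigcup (F : _^nat) : (forall i, g_sigma_preimage coors (F i)) ->
  g_sigma_preimage coors (\bigcup_i (F i)).
Proof. exact: sigma_algebra_bigcup. Qed.

HB.instance Definition _ := @isMeasurable.Build (measure_tuple_display d)
  'rV[T]_n (g_sigma_preimage coors) rV_set0 rV_setC rV_bigcup.

End measurable_rV.

Section lebesgue_rV.
Context {R : realType}.

Definition rV_cons n (z : 'rV[R]_n * measurableTypeR R) : 'rV[R]_n.+1 :=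
  row_mx (z.2 : R)%:M z.1.

Lemma measurable_rV_coord n (i : 'I_n) :
  measurable_fun [set: 'rV[R]_n] (fun v => v ord0 i).
Proof.
move=> _ Y mY; rewrite setTI; apply: sub_sigma_algebra => /=.
rewrite -bigcup_seq/=; exists i => /=; first by rewrite mem_index_enum.
by exists Y => //; rewrite setTI.
Qed.

Lemma measurable_rV_cons n : measurable_fun setT (@rV_cons n).
Proof.
suff H : g_sigma_preimage (fun (i : 'I_n.+1) z => @rV_cons n z ord0 i)
    `<=` measurable.
  move=> _ A mA; rewrite setTI; apply: H.
  rewrite (@g_sigma_preimage_comp _ R n.+1 'rV[R]_n.+1
    (fun i (v : 'rV[R]_n.+1) => v ord0 i)).
  by exists A => //; rewrite setTI.
apply: smallest_sub; first exact: sigma_algebra_measurable.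
rewrite -bigcup_mkord_ord; apply: bigcup_sub => i _ A [B mB <-].
case: (split_ordP (inord i : 'I_(1 + n))) => j ij.
- rewrite (_ : (fun z => _) = fun z : 'rV[R]_n * measurableTypeR R => z.2).
    exact: measurable_snd.
  apply/funext => z; rewrite /rV_cons ij.
  have := row_mxEl ((z.2 : R)%:M : 'M[R]_1) z.1 ord0 j.
  by rewrite !mxE !ord1 => ->.
- rewrite (_ : (fun z => _) =
      fun z : 'rV[R]_n * measurableTypeR R => z.1 ord0 j).
    have mj := measurableT_comp (measurable_rV_coord j)
      (@measurable_fst _ _ _ (measurableTypeR R)).
    exact: mj.
  apply/funext => z; rewrite /rV_cons ij.
  exact: (row_mxEr ((z.2 : R)%:M : 'M[R]_1) z.1 ord0 j).
Qed.

Section lebesgue_rV_succ.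
Variables (n : nat) (mu : {measure set 'rV[R]_n -> \bar R}).
Let mcons := @measurable_rV_cons n.

Definition lebesgue_rV_succ : set 'rV[R]_n.+1 -> \bar R :=
  pushforward (mu \x lebesgue_measure)%E (@rV_cons n).

Let succ0 : lebesgue_rV_succ set0 = 0%E.
Proof. exact: measure0. Qed.

Let succ_ge0 A : (0 <= lebesgue_rV_succ A)%E.
Proof. exact: measure_ge0. Qed.

Let succ_sigma_additive : semi_sigma_additive lebesgue_rV_succ.
Proof. exact: measure_semi_sigma_additive. Qed.

HB.instance Definition _ := isMeasure.Build _ _ _ lebesgue_rV_succ
  succ0 succ_ge0 succ_sigma_additive.

End lebesgue_rV_succ.

(* Lebesgue measure on R^n, as an iterated product of the one on R *)
Fixpoint lebesgue_rV n : {measure set 'rV[R]_n -> \bar R} :=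
  if n is n'.+1 then lebesgue_rV_succ (lebesgue_rV n')
  else \d_(0 : 'rV[R]_0).

End lebesgue_rV.

Section domains.
Context {R : realType} {N : nat}.
Implicit Types (Omega U : set 'rV[R]_N) (f : 'rV[R]_N -> R).

(* the norm provided by the library on matrices is the sup norm *)
Definition enorm (x : 'rV[R]_N) : R := Num.sqrt (\sum_i x ord0 i ^+ 2).

(* C^k regularity on an open set U *)
Fixpoint Ck (k : nat) U f : Prop :=
  (forall x, U x -> {for x, continuous f}) /\
  if k is k'.+1 then
    forall i : 'I_N, (forall x, U x -> derivable f x (delta_mx ord0 i)) /\
                     Ck k' U ('D_(delta_mx ord0 i) f)
  else True.

Definition Cinfty U f := forall k, Ck k U f.

(* Near each boundary point, Omega is the negativity set of a smooth function
   without critical points. For Omega open, closure Omega `\` Omega is its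
   boundary. *)
Definition smooth_boundary Omega :=
  forall x0, (closure Omega `\` Omega) x0 ->
  exists (U : set 'rV[R]_N) (rho : 'rV[R]_N -> R),
    [/\ open U, U x0, Cinfty U rho,
      forall x, U x -> exists i : 'I_N, 'D_(delta_mx ord0 i) rho x != 0 &
      Omega `&` U = [set x | U x /\ rho x < 0]].

Definition smooth_bounded_domain Omega :=
  [/\ open Omega, connected Omega, Omega !=set0, bounded_set Omega &
      smooth_boundary Omega].

End domains.

Section fractional.
Context {R : realType} {N : nat}.
Implicit Types (s q : R) (Omega : set 'rV[R]_N) (f g u V : 'rV[R]_N -> R).

Local Notation mu := (@lebesgue_rV R N).

(* A function on Omega is represented by a function on R^N, of which only the
   restriction to Omega matters. *)
Definition ae_on Omega (P : 'rV[R]_N -> Prop) :=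
  {ae mu, forall x, Omega x -> P x}.

Definition norm_Lp Omega (p : \bar R) f : \bar R :=
  Lnorm mu p (EFin \o (f \_ Omega)).

Definition in_Lp Omega (p : \bar R) f :=
  measurable_fun Omega f /\ (norm_Lp Omega p f < +oo)%E.

(* C_{N,s}; the sum selects the coordinate zeta_1 *)
Definition fracC s : R :=
  (fine (\int[mu]_z ((1 - cos (\sum_(i < N | val i == 0%N) z ord0 i)) /
                     enorm z `^ (N%:R + 2 * s))%:E))^-1.

(* [u]_s *)
Definition gagliardo s u : \bar R :=
  ((\int[mu]_x \int[mu]_y (`|u x - u y| ^+ 2 /
                           enorm (x - y) `^ (N%:R + 2 * s))%:E) `^ 2^-1)%E.

Definition H0s s Omega u :=
  [/\ in_Lp setT 2%:E u, (gagliardo s u < +oo)%E &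
      ae_on (~` Omega) (fun x => u x = 0)].

Definition conj_exp q : R := q / (q - 1).

Definition embedding_bound s q Omega (C : R) :=
  forall u, H0s s Omega u ->
    (norm_Lp Omega (2 * conj_exp q)%:E u <= C%:E * gagliardo s u)%E.

Definition best_embedding_constant s q Omega (C : R) :=
  embedding_bound s q Omega C /\
  forall C', embedding_bound s q Omega C' -> C <= C'.

Definition rayleigh s Omega g V u : R :=
  (fracC s / 2 * fine (gagliardo s u) ^+ 2
     + \int[mu]_(x in Omega) (V x * `|u x| ^+ 2))
  / \int[mu]_(x in Omega) (g x * `|u x| ^+ 2).

Definition admissible s Omega g u :=
  H0s s Omega u /\ 0 < \int[mu]_(x in Omega) (g x * `|u x| ^+ 2).

Definition lambda1 s Omega g V : \bar R :=
  ereal_inf [set (rayleigh s Omega g V u)%:E | u in admissible s Omega g].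

Definition first_eigenfunction s Omega g V u :=
  admissible s Omega g u /\ (rayleigh s Omega g V u)%:E = lambda1 s Omega g V.

(* E(phi) *)
Definition rearrangements Omega f : set ('rV[R]_N -> R) :=
  [set h | measurable_fun Omega h /\
     forall t : R, mu (Omega `&` [set x | t < h x]) =
                   mu (Omega `&` [set x | t < f x])].

End fractional.

Arguments fracC {R} N s.

(* Main.v *)
Require Import Defs.
From HB Require Import structures.
From mathcomp Require Import all_boot all_order all_algebra.
From mathcomp Require Import all_classical all_reals all_analysis.
From mathcomp Require Import measurable_realfun ess_sup_inf ring lra.

Set Implicit Arguments.
Unset Strict Implicit.
Unset Printing Implicit Defensive.
Import Order.TTheory GRing.Theory Num.Theory.
Import numFieldNormedType.Exports.

Local Open Scope classical_set_scope.
Local Open Scope ring_scope.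

(** Write [lam] for the minimal value, attained at [u] for the pair
    [(gl, Vl)], and let [g'] be a rearrangement of [g0] such that the integral
    of [g' * u ^ 2] is at least that of [gl * u ^ 2]. The numerator of the
    Rayleigh quotient is positive at [u] ([num_gt0]: Hoelder, the embedding
    constant and the bound on the negative part of the potential), so passing
    from [gl] to [g'] does not increase the quotient of [u]; by minimality no
    admissible function has a quotient below [lam] for either pair. Hence [u]
    is a critical point of both quotients, with the same critical value.
    Subtracting the two Euler-Lagrange equations, in which the energy and the
    potential are the same, leaves [lam * \int (gl - g') u^2 w = 0] for every
    bounded [w] such that [u * w] has finite energy ([stationarity_exchange]).
    As [lam > 0] and [u > 0], the weight [gl] cannot differ from [g'] in a way
    that such a [w] detects. The potential is treated in the same way, with
    [- Vl] in the role of [gl].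

    It remains to build [g'] when [gl] is not ordered like [u], that is when
    [gl > c] on a non-null part of [u <= t] and [gl < c] on a non-null part of
    [u >= t]. Some translate of the second part meets the first one in a
    non-null set ([translate_meets]); exchanging that set with its translate
    is an involution [T] preserving Lebesgue measure, so [g' = gl \o T] is a
    rearrangement, and the rearrangement inequality [involution_integral_le]
    shows that it does not decrease the integral against [u ^ 2]. Equality is
    allowed there, which is why the flat parts of [u] require no separate
    treatment.

    The direction [w] only has to be positive on one of the two exchanged
    pieces and negative on the other. Because the level sets of [cos x_1] are
    null, the pieces can be shrunk so that some [w = e * (cos x_1 - k)] does
    this ([separating_threshold]). The function [u * w] has finite Gagliardo
    energy because the difference quotients of [cos x_1] are controlled by the
    integral whose inverse is the normalization constant [fracC N s]
    ([cos_weight_quotient]), and that integral is finite as the constant is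
    positive.

    Finally, [gl] being ordered like [u] at all thresholds, it is almost
    everywhere the value at [u] of the function sending [t] to the essential
    infimum of [gl] on [u >= t] ([ae_nondecreasing_factor]). *)

(** * Lebesgue measure on row vectors *)

Definition image_measure d d' (T1 : measurableType d) (T2 : measurableType d')
    (R : realType) (m : {measure set T1 -> \bar R}) (f : T1 -> T2)
    (mf : measurable_fun setT f) : {measure set T2 -> \bar R} :=
  measure_function_pushforward__canonical__measure_function_Measure m mf.

Section sigma_finite_of.
Context d (T : measurableType d) (R : realType).

Definition sigma_finite_of (mu : {measure set T -> \bar R})
  of sigma_finite setT mu : set T -> \bar R := mu.

Variables (mu : {measure set T -> \bar R}) (h : sigma_finite setT mu).

HB.instance Definition _ := Measure.copy (sigma_finite_of h) mu.
HB.instance Definition _ :=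
  Measure_isSigmaFinite.Build _ _ _ (sigma_finite_of h) h.

End sigma_finite_of.

Section euclidean_measure.
Context {R : realType}.

(** The sigma-algebra of row vectors is generated by the coordinates. *)
Lemma measurable_rVP d (T : measurableType d) n (f : T -> 'rV[R]_n) :
  (forall i, measurable_fun setT (fun x => f x ord0 i)) -> measurable_fun setT f.
Proof.
move=> mf.
suff H : g_sigma_preimage (fun (i : 'I_n) z => f z ord0 i) `<=` measurable.
  move=> _ A mA; rewrite setTI; apply: H.
  rewrite (@g_sigma_preimage_comp _ R n 'rV[R]_n
    (fun i (v : 'rV[R]_n) => v ord0 i)).
  by exists A => //; rewrite setTI.
apply: smallest_sub; first exact: sigma_algebra_measurable.
rewrite -bigcup_seq; apply: bigcup_sub => i _ A [B mB <-].
exact: mf.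
Qed.

Lemma rV_consD n (z w : 'rV[R]_n * measurableTypeR R) :
  rV_cons z + rV_cons w = rV_cons (z.1 + w.1, (z.2 : R) + w.2).
Proof.
apply/matrixP => i j; rewrite !mxE.
by case: (fintype.split _) => k; rewrite !mxE ?mulrnDl.
Qed.

Lemma rV_unconsK n (a : 'rV[R]_n.+1) :
  a = rV_cons (rsubmx (a : 'rV[R]_(1 + n)), a ord0 ord0).
Proof.
apply/matrixP => i j; rewrite !mxE ord1; case: (split_ordP (j : 'I_(1 + n))) => k ->.
  by rewrite !mxE ord1 eqxx mulr1n; congr (a _ _); exact/val_inj.
by rewrite !mxE.
Qed.

Lemma rV_cons0 n (z : 'rV[R]_n * measurableTypeR R) :
  rV_cons z ord0 ord0 = z.2.
Proof.
rewrite /rV_cons mxE; case: (split_ordP (ord0 : 'I_(1 + n))) => k.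
  by move=> _; rewrite mxE !ord1 eqxx mulr1n.
by move/(congr1 val).
Qed.

Definition rV_uncons n (v : 'rV[R]_n.+1) : 'rV[R]_n * measurableTypeR R :=
  (rsubmx (v : 'rV[R]_(1 + n)), v ord0 ord0).

Lemma rV_consK n : cancel (@rV_cons R n) (@rV_uncons n).
Proof.
move=> z; rewrite /rV_uncons rV_cons0.
rewrite [RHS]surjective_pairing; congr (_, _).
by apply/matrixP => i j; rewrite mxE /rV_cons (row_mxEr ((z.2 : R)%:M : 'M[R]_1) z.1).
Qed.

Lemma measurable_rV_uncons n : measurable_fun setT (@rV_uncons n).
Proof.
apply: measurable_fun_pair => /=; last exact: measurable_rV_coord.
apply: measurable_rVP => i.
rewrite (_ : (fun _ => _) = fun v : 'rV[R]_n.+1 => v ord0 (rshift 1 i)).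
  exact: measurable_rV_coord.
by apply/funext => v; rewrite mxE.
Qed.

Lemma lebesgue_rVS n (A : set ('rV[R]_n * measurableTypeR R)) :
  lebesgue_rV n.+1 (@rV_uncons n @^-1` A) = (lebesgue_rV n \x lebesgue_measure)%E A.
Proof.
rewrite /= /lebesgue_rV_succ /pushforward; congr (_ _).
by apply/seteqP; split => z /=; rewrite rV_consK.
Qed.

Lemma lebesgue_rV_sigma_finite n : sigma_finite setT (@lebesgue_rV R n).
Proof.
elim: n => [|n IH].
  exists (fun=> setT); first by rewrite bigcup_const.
  by move=> k; split => //=; rewrite diracT ltry.
have /sigma_finiteP[F [FT ndF Ffin]] := sigma_finiteT (sigma_finite_of IH).
have /sigma_finiteP[G [GT ndG Gfin]] := sigma_finiteT (@lebesgue_measure R).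
exists (fun k => @rV_uncons n @^-1` (F k `*` G k)).
  apply/esym/seteqP; split => // v _.
  have [k _ Fk] : (\bigcup_k F k) (rV_uncons v).1 by rewrite -FT.
  have [l _ Gl] : (\bigcup_k G k) (rV_uncons v).2 by rewrite -GT.
  exists (maxn k l) => //; split.
    by move: Fk; exact/subsetPset/ndF/leq_maxl.
  by move: Gl; exact/subsetPset/ndG/leq_maxr.
move=> k; have [mF Ffin'] := Ffin k; have [mG Gfin'] := Gfin k; split.
  rewrite -[X in measurable X]setTI; apply: measurable_rV_uncons => //.
  exact: measurableX.
by rewrite lebesgue_rVS product_measure1E// lte_mul_pinfty// ge0_fin_numE.
Qed.

(** Fubini's theorem is stated for bundled sigma-finite measures; this measure
    is convertible to [lebesgue_rV n]. *)
Definition sf_lebesgue_rV n : {sigma_finite_measure set 'rV[R]_n -> \bar R} :=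
  sigma_finite_of (@lebesgue_rV_sigma_finite n).

Arguments sf_lebesgue_rV : simpl never.

Lemma lebesgue_measure_shift (a : R) (A : set (measurableTypeR R)) :
  measurable A -> lebesgue_measure [set x : R | A (x + a)] = lebesgue_measure A.
Proof.
move=> mA.
have ms : measurable_fun setT (fun x : measurableTypeR R => (x : R) + a : measurableTypeR R).
  exact: measurable_funD.
have := @lebesgue_measure_unique R (image_measure lebesgue_measure ms) _ A mA.
rewrite /= /pushforward => -> // _ /ocitvP[->|[[x y] /= xy ->]].
  by rewrite preimage_set0 !measure0.
rewrite (_ : _ @^-1` _ = [set` `](x - a), (y - a)]]).
  by rewrite !lebesgue_measure_itv/= !lte_fin ltrD2r xy -!EFinB; congr EFin; ring.
by apply/seteqP; split => z /=; rewrite !in_itv/= ltrBlDr lerBrDr.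
Qed.

Lemma measurable_rV_shift n (a : 'rV[R]_n) :
  measurable_fun setT (fun x : 'rV[R]_n => x + a).
Proof.
apply: measurable_rVP => i; under eq_fun do rewrite mxE.
by apply: measurable_funD => //; exact: measurable_rV_coord.
Qed.

(** By induction on the dimension, both sides agree on the rectangles that
    generate the product sigma-algebra. *)
Lemma lebesgue_rV_shift n (a : 'rV[R]_n) (A : set 'rV[R]_n) : measurable A ->
  sf_lebesgue_rV n [set x | A (x + a)] = sf_lebesgue_rV n A.
Proof.
elim: n a A => [|n IH] a A mA.
  by congr (sf_lebesgue_rV _ _); apply/seteqP; split => x /=; rewrite (thinmx0 a) addr0.
have ms : measurable_fun setT (fun z : 'rV[R]_n * measurableTypeR R =>
    (z.1 + (rV_uncons a).1, (z.2 : R) + (rV_uncons a).2 : measurableTypeR R)).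
  apply: measurable_fun_pair.
    exact: (measurableT_comp (measurable_rV_shift _) measurable_fst).
  apply: measurable_funD => //; exact: measurable_snd.
pose B := @rV_cons R n @^-1` A.
have mB : measurable B.
  by rewrite -[X in measurable X]setTI; apply: measurable_rV_cons.
transitivity ((sf_lebesgue_rV n \x lebesgue_measure)%E B); last by [].
transitivity ((image_measure (sf_lebesgue_rV n \x lebesgue_measure)%E ms) B).
  rewrite /= /lebesgue_rV_succ /image_measure/= /pushforward; congr (_ _).
  apply/funext => z; rewrite /B /= {1}[a]rV_unconsK.
  by congr (A _); exact: rV_consD.
apply/esym/product_measure_unique => // C D mC mD /=.
rewrite /pushforward (_ : _ @^-1` _ = [set x | C (x + (rV_uncons a).1)] `*`
  [set x : measurableTypeR R | D ((x : R) + (rV_uncons a).2)]); last first.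
  by apply/seteqP; split => z.
rewrite product_measure1E.
- by congr (_ * _)%E; [exact: IH | exact: lebesgue_measure_shift].
- by rewrite -[X in measurable X]setTI; exact: measurable_rV_shift.
- rewrite -[X in measurable X]setTI.
  exact: (@measurable_funD _ _ _ setT (@id (measurableTypeR R)) (cst (rV_uncons a).2)).
Qed.

(** * Open, bounded and null sets *)

Lemma measurable_rV_box n (P : 'I_n -> set R) :
  (forall i, measurable (P i)) ->
  measurable [set x : 'rV[R]_n | forall i, P i (x ord0 i)].
Proof.
move=> mP.
rewrite (_ : mkset _ =
    \bigcap_(i in [set: 'I_n]) ((fun x : 'rV[R]_n => x ord0 i) @^-1` P i)).
  apply: fin_bigcap_measurable; first exact: finite_finset.
  move=> i _; rewrite -[X in measurable X]setTI.
  exact: measurable_rV_coord.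
by apply/seteqP; split => x /= Px i; [move=> _; exact: Px | exact: Px].
Qed.

(** Every open set is the union of the boxes with rational center and radius
    that it contains. *)
Lemma open_measurable_rV n (A : set 'rV[R]_n) : open A -> measurable A.
Proof.
move=> oA.
pose box (p : 'rV[rat]_n * nat) := [set x : 'rV[R]_n |
  forall i, `](ratr (p.1 ord0 i) - p.2.+1%:R^-1),
              (ratr (p.1 ord0 i) + p.2.+1%:R^-1)[%classic (x ord0 i)].
rewrite (_ : A = \bigcup_p (if `[< box p `<=` A >] then box p else set0)).
  apply: countable_bigcupT_measurable => // p.
  case: ifP => // _; apply: (@measurable_rV_box _ (fun i =>
    `](ratr (p.1 ord0 i) - p.2.+1%:R^-1), (ratr (p.1 ord0 i) + p.2.+1%:R^-1)[%classic)) => i.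
  exact: measurable_itv.
apply/seteqP; split => [x Ax|x [p _]]; last first.
  by case: asboolP => [bA /bA|_ []].
have /nbhs_ballP[e /= e0 xeA] := open_nbhs_nbhs (conj oA Ax).
have [k ke] : exists k, k.+1%:R^-1 < e / 2.
  exists (Num.truncn (e / 2)^-1); rewrite invf_plt ?posrE ?divr_gt0 ?ltr0n//.
  exact: truncnS_gt.
have /choice[f fx] (i : 'I_n) : exists r : rat,
    ratr r \in `](x ord0 i - k.+1%:R^-1), (x ord0 i + k.+1%:R^-1)[.
  apply: rat_in_itvoo; rewrite ltrBlDr -addrA ltrDl.
  by rewrite addr_gt0// invr_gt0 ltr0n.
pose p := (\row_i f i, k).
have bx : box p x.
  move=> i; have := fx i; rewrite /= !in_itv/= !mxE => /andP[? ?]; apply/andP.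
  by split; [rewrite ltrBlDr|rewrite -ltrBlDr].
exists p => //; rewrite asboolT// => y yp; apply: xeA.
split => // i j; rewrite (ord1 i); move: (yp j) (bx j).
rewrite /ball /= !in_itv/= ltr_distlC; move: (ratr _) (k.+1%:R^-1) ke => c d ke.
by move=> /andP[? ?] /andP[? ?]; apply/andP; split; lra.
Qed.

Lemma bounded_lebesgue_rV_lty n (A : set 'rV[R]_n) :
  bounded_set A -> measurable A -> (sf_lebesgue_rV n A < +oo)%E.
Proof.
move=> [M0 [_ AM0]] mA; pose M := M0 + 1.
have AM x : A x -> `|x| <= M by apply: AM0; rewrite ltrDl.
pose box n := [set x : 'rV[R]_n | forall i, `[-M, M]%classic (x ord0 i)].
have mbox m : measurable (box m) by
  apply: (@measurable_rV_box _ (fun=> `[-M, M]%classic)) => i; exact: measurable_itv.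
suff H m : (sf_lebesgue_rV m (box m) < +oo)%E.
  apply: le_lt_trans (H n); apply: le_measure; rewrite ?inE//.
    exact: mbox.
  move=> x /AM /= xM i; rewrite /= in_itv/= -ler_norml.
  apply: le_trans xM; rewrite [leRHS]/Num.Def.normr /= mx_normrE.
  by apply/bigmax_geP; right => /=; exists (ord0, i).
elim: m => [|m IH]; first by rewrite /= diracE; case: (_ \in _); rewrite ?ltry.
have le : (sf_lebesgue_rV m.+1 (box m.+1) <=
    sf_lebesgue_rV m (box m) * lebesgue_measure (`[(- M)%R, M]%classic : set R))%E.
  rewrite -product_measure1E//; last exact: mbox.
  rewrite -[leRHS]lebesgue_rVS; apply: le_measure; rewrite ?inE; first exact: mbox.
    rewrite -[X in measurable X]setTI; apply: measurable_rV_uncons => //.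
    by apply: measurableX => //; exact: mbox.
  by move=> x bx; split => [i|] /=; [rewrite mxE|]; exact: bx.
apply: le_lt_trans le _; rewrite lte_mul_pinfty// ?ge0_fin_numE//.
by rewrite lebesgue_measure_itv/=; case: ifP => _; rewrite ?ltry// -EFinB ltry.
Qed.

Lemma lebesgue_rV_coord0 n (Z : set (measurableTypeR R)) :
  measurable Z -> lebesgue_measure Z = 0%E ->
  sf_lebesgue_rV n.+1 [set x | Z (x ord0 ord0)] = 0%E.
Proof.
move=> mZ Z0.
transitivity (sf_lebesgue_rV n.+1 (@rV_uncons n @^-1` (setT `*` Z))).
  by congr (sf_lebesgue_rV _ _); apply/seteqP; split => x //= [].
etransitivity; first exact: lebesgue_rVS.
etransitivity; first exact: product_measure1E.
by move: Z0 => /= ->; rewrite mule0.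
Qed.

(** Modulo sign, a solution of [cos t = k] is [acos k] or [acos (- k)] plus a
    multiple of [pi], so there are only countably many. *)
Lemma cos_level_null (k : R) : lebesgue_measure [set t : R | cos t = k] = 0%E.
Proof.
apply: countable_lebesgue_measure0.
pose f (p : nat * bool * bool) : R :=
  (-1) ^+ p.1.2 * (acos ((-1) ^+ p.2 * k) + pi *+ p.1.1).
suff : [set t | cos t = k] `<=` range f.
  move=> /subset_card_le/sub_countable; apply.
  exact: sub_countable (card_image_le _ _) _.
move=> t /= tk.
pose n := Num.truncn (`|t| / pi); pose r : R := `|t| - pi *+ n.
have p0 := @pi_gt0 R.
have /andP[r0 r1] : 0 <= r <= pi.
  have : n%:R <= `|t| / pi < n.+1%:R by apply: truncn_itv; rewrite divr_ge0// ltW.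
  rewrite ler_pdivlMr// ltr_pdivrMr// /r -mulr_natl -natr1 mulrDl mul1r.
  by lra.
have tr : `|t| = r + pi *+ n by rewrite /r subrK.
have ck : cos r = (-1) ^+ n * k.
  by rewrite -tk -(cos_norm t) tr (alternatingn (@cosDpi R)) signrMK.
exists (n, t < 0, odd n) => //; rewrite /f /= signr_odd -ck cosK ?in_itv/= ?r0//.
rewrite -tr; case: (ltP t 0) => t0.
  by rewrite ltr0_norm// expr1 mulN1r opprK.
by rewrite ger0_norm// expr0 mul1r.
Qed.
End euclidean_measure.

(** * Measure-preserving maps and exchanges of translates *)

Section measure_preserving.
Context d (T : measurableType d) (R : realType).
Variables (mu : {measure set T -> \bar R}) (phi : T -> T).
Hypothesis mphi : measurable_fun setT phi.
Hypothesis phi_mu : forall A, measurable A -> mu (phi @^-1` A) = mu A.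

Lemma ge0_integral_preserved (f : T -> \bar R) :
  measurable_fun setT f -> (forall x, 0 <= f x)%E ->
  (\int[mu]_x f (phi x) = \int[mu]_x f x)%E.
Proof.
move=> mf f0; rewrite -[LHS](@ge0_integral_pushforward _ _ _ _ _ _ mphi mu setT f)//.
by apply: (eq_measure_integral mu) => A mA _; exact: phi_mu.
Qed.

Lemma integrable_preserved (f : T -> R) :
  mu.-integrable setT (EFin \o f) -> mu.-integrable setT (EFin \o (f \o phi)).
Proof.
move=> /integrableP[mf fi]; apply/integrableP; split.
  exact: (measurableT_comp mf mphi).
have mabs := measurableT_comp (@abse_measurable R setT) mf.
by have /= -> := @ge0_integral_preserved _ mabs (fun=> abse_ge0 _).
Qed.

Lemma Rintegral_preserved (f : T -> R) :
  mu.-integrable setT (EFin \o f) ->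
  \int[mu]_x f (phi x) = \int[mu]_x f x.
Proof.
move=> fi; congr fine.
have /integrableP[mf _] := fi.
rewrite -[LHS](@integral_pushforward _ _ _ _ _ _ mphi mu setT (EFin \o f))//.
  by apply: (eq_measure_integral mu) => A mA _; exact: phi_mu.
exact: integrable_preserved.
Qed.

End measure_preserving.

Section translation_swap.
Context {R : realType} {N : nat}.
Local Notation mu := (@sf_lebesgue_rV R N).

Lemma measurable_shift (A : set 'rV[R]_N) a : measurable A ->
  measurable [set x | A (x + a)].
Proof. by move=> mA; rewrite -[X in measurable X]setTI; exact: measurable_rV_shift. Qed.

(** When [D] is disjoint from its translate by [a], this exchanges the two sets
    and fixes all other points. *)
Definition swap (D : set 'rV[R]_N) (a x : 'rV[R]_N) : 'rV[R]_N :=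
  if x \in D then x + a else if x - a \in D then x - a else x.

Lemma swapK (D : set 'rV[R]_N) (a : 'rV[R]_N) :
  (forall x, D x -> ~ D (x + a)) -> involutive (swap D a).
Proof.
move=> Da x; rewrite /swap.
have Dx (y : 'rV[R]_N) : y \in D -> y + a \in D = false.
  by move=> /set_mem/Da yD; apply/negP => /set_mem.
have [xD|xD] := boolP (x \in D); first by rewrite (Dx x xD) addrK xD.
have [xaD|xaD] := boolP (x - a \in D); first by rewrite xaD subrK.
by rewrite (negbTE xD) (negbTE xaD).
Qed.

Lemma preimage_swap (D : set 'rV[R]_N) (a : 'rV[R]_N) (S : set 'rV[R]_N) :
  swap D a @^-1` S = (D `&` [set x | S (x + a)])
    `|` (([set x | D (x - a)] `\` D) `&` [set x | S (x - a)])
    `|` (S `\` (D `|` [set x | D (x - a)])).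
Proof.
apply/seteqP; split => x /=; rewrite /swap.
  case: ifPn => [/set_mem xD Sx|/negP/(contra_not mem_set) xD].
    by left; left.
  case: ifPn => [/set_mem xaD Sx|/negP/(contra_not mem_set) xaD Sx].
    by left; right.
  by right; split => // -[].
move=> [[[xD Sx]|[[xaD xD] Sx]]|[Sx xD]].
- by rewrite (@mem_set _ D).
- by rewrite (@memNset _ D)// (@mem_set _ D).
- by rewrite !(@memNset _ D)// => ?; apply: xD; [right|left].
Qed.

Section swap_preserves.
Variables (D : set 'rV[R]_N) (a : 'rV[R]_N).
Hypothesis mD : measurable D.
Hypothesis Da : forall x, D x -> ~ D (x + a).

Let mDa : measurable [set x | D (x - a)].
Proof. exact: measurable_shift. Qed.

Lemma measurable_swap : measurable_fun setT (swap D a).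
Proof.
move=> _ S mS; rewrite setTI preimage_swap.
have mSa := measurable_shift a mS; have mSb := measurable_shift (- a) mS.
apply: measurableU; last by apply: measurableD => //; exact: measurableU.
apply: measurableU; first exact: measurableI.
by apply: measurableI => //; exact: measurableD.
Qed.

Lemma swap_preserving S : measurable S -> mu (swap D a @^-1` S) = mu S.
Proof.
move=> mS; rewrite preimage_swap.
have mSa := measurable_shift a mS; have mSb := measurable_shift (- a) mS.
have DaD : [set x | D (x - a)] `\` D = [set x | D (x - a)].
  apply/seteqP; split => [x []//|x /= xD]; split => // Dx.
  by apply: (Da xD); rewrite subrK.
rewrite DaD measureU/=; last 3 first.
- by apply: measurableU; exact: measurableI.
- by apply: measurableD => //; exact: measurableU.
- apply/seteqP; split => // x /= [[[xD _]|[xD _]] [_ +]]; apply; first by left.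
  by right.
rewrite measureU/=; last 3 first.
- exact: measurableI.
- exact: measurableI.
- apply/seteqP; split => // x /= [[xD _] [xaD _]].
  by apply: (Da xaD); rewrite subrK.
have -> : mu (D `&` [set x | S (x + a)]) = mu ([set x | D (x - a)] `&` S).
  rewrite -[RHS](lebesgue_rV_shift a); last exact: measurableI.
  by congr (mu _); apply/seteqP; split => x /=; rewrite addrK.
have -> : mu ([set x | D (x - a)] `&` [set x | S (x - a)]) = mu (D `&` S).
  by rewrite -[RHS](lebesgue_rV_shift (- a)) //; exact: measurableI.
rewrite -measureU/=; last 3 first.
- exact: measurableI.
- exact: measurableI.
- apply/seteqP; split => // x /= [[xaD _] [xD _]].
  by apply: (Da xaD); rewrite subrK.
rewrite -measureU/=; last 3 first.
- by apply: measurableU; exact: measurableI.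
- by apply: measurableD => //; exact: measurableU.
- apply/seteqP; split => // x /= [[[xD _]|[xD _]] [_ +]]; apply; first by right.
  by left.
congr (mu _); apply/seteqP; split => x /=; first by case=> [[]|] [].
move=> Sx; have [xD|xD] := pselect (D x); first by left; right.
have [xaD|xaD] := pselect (D (x - a)); first by left; left.
by right; split => // -[].
Qed.

End swap_preserves.

Lemma measurable_addrV :
  measurable_fun setT (fun z : 'rV[R]_N * 'rV[R]_N => z.1 + z.2).
Proof.
apply: measurable_rVP => i; under eq_fun do rewrite mxE.
apply: measurable_funD.
  exact: (measurableT_comp (measurable_rV_coord i) measurable_fst).
exact: (measurableT_comp (measurable_rV_coord i) measurable_snd).
Qed.

(** Integrating the measure of [A `&` (B - a)] over all translations [a] gives
    the product of the measures of [A] and [B]. *)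
Lemma translate_meets (A B : set 'rV[R]_N) : measurable A -> measurable B ->
  (0 < mu A)%E -> (0 < mu B)%E ->
  exists a, (0 < mu [set x | A x /\ B (x + a)%R])%E.
Proof.
move=> mA mB A0 B0; apply: contrapT => /forallNP H.
have H0 a : mu [set x | A x /\ B (x + a)] = 0%E.
  by apply/eqP; have /negP := H a; rewrite lt0e negb_and measure_ge0 orbF negbK.
pose S := [set z : 'rV[R]_N * 'rV[R]_N | A z.1 /\ B (z.1 + z.2)].
have mS : measurable S.
  apply: measurableI.
    by rewrite -[X in measurable X]setTI; exact: measurable_fst.
  by rewrite -[X in measurable X]setTI; exact: measurable_addrV.
have mf : measurable_fun setT (EFin \o \1_S : _ -> \bar R).
  by apply/measurable_EFinP; exact: measurable_indic.
have f0 z : (0 <= (EFin \o \1_S : _ -> \bar R) z)%E by rewrite /= lee_fin.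
have := fubini_tonelli (m1 := mu) (m2 := mu) _ mf f0.
rewrite [X in _ = X -> _]integral0_eq; last first.
  move=> a _; transitivity (\int[mu]_x (\1_[set x | A x /\ B (x + a)] x)%:E)%E.
    by [].
  rewrite integral_indic ?setIT//; first exact: H0.
  by apply: measurableI => //; exact: measurable_shift.
rewrite (eq_integral (fun x => (\1_A x)%:E * mu B))%E; last first.
  move=> x _; transitivity (\int[mu]_a ((\1_A x)%:E * (\1_[set a | B (a + x)] a)%:E))%E.
    apply: eq_integral => a _; rewrite /= -EFinM; congr EFin.
    rewrite !indicE -natrM mulnb; congr (_%:R); congr (nat_of_bool _).
    by apply/idP/idP => [/set_mem[/mem_set-> /= xa]|/andP[/set_mem xA /set_mem xa]];
      apply/mem_set => //=; [rewrite addrC|split; rewrite // addrC].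
  rewrite ge0_integralZl ?integral_indic ?setIT//.
  - by congr (_ * _)%E; exact: lebesgue_rV_shift.
  - exact: measurable_shift.
  - by apply/measurable_EFinP; apply: measurable_indic; exact: measurable_shift.
rewrite ge0_integralZr ?integral_indic ?setIT//; last first.
  by apply/measurable_EFinP; exact: measurable_indic.
by apply/eqP; rewrite mule_neq0 // gt_eqF.
Qed.

End translation_swap.

(** * Almost everywhere monotone dependence *)

Section negligible_families.
Context d (T : measurableType d) (R : realType).
Variable mu : {measure set T -> \bar R}.

Lemma negligible_bigcup_countType (I : countType) (F : I -> set T) :
  (forall q, mu.-negligible (F q)) -> mu.-negligible (\bigcup_q F q).
Proof.
move=> F0.
pose G n := if (unpickle n : option I) is Some q then F q else set0.
apply: (@negligibleS _ _ _ mu (\bigcup_n G n)).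
  by move=> x [q _ Fx]; exists (pickle q) => //; rewrite /G pickleK.
apply: negligible_bigcup => n; rewrite /G.
by case: unpickle => [q|]; [exact: F0|exact: negligible_set0].
Qed.

Lemma negligible_bigcup_rat (F : rat -> set T) :
  (forall q, mu.-negligible (F q)) -> mu.-negligible (\bigcup_q F q).
Proof. exact: negligible_bigcup_countType. Qed.

Lemma ae_rat (P : rat -> T -> Prop) :
  (forall q, {ae mu, forall x, P q x}) -> {ae mu, forall x, forall q, P q x}.
Proof.
move=> /negligible_bigcup_rat; apply: negligibleS => x /existsNP[q Pq].
by exists q.
Qed.

(** [S] is the union of the countably many sets [S `&` [set y | q <= u y]] with
    [q] rational above some value of [u] on [S], and of the set of minimizers
    of [u] on [S], on which [u] is constant; each of them lies in one of the
    sets of the hypothesis. *)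
Lemma negligible_superlevels (u : T -> R) (S : set T) :
  (forall x, S x -> mu.-negligible (S `&` [set y | u x <= u y])) ->
  mu.-negligible S.
Proof.
move=> H.
pose F q := [set y | S y /\ ratr q <= u y /\ exists2 x, S x & u x <= ratr q].
pose M := [set y | S y /\ forall x, S x -> u y <= u x].
apply: (@negligibleS _ _ _ mu (M `|` \bigcup_q F q)).
  move=> y Sy; have [?|] := pselect (forall x, S x -> u y <= u x).
    by left.
  move=> /existsNP[x /not_implyP[Sx /negP]]; rewrite -ltNge.
  move=> /rat_in_itvoo[q]; rewrite in_itv/= => /andP[xq qy].
  by right; exists q => //; split => //; split; [exact: ltW|exists x => //; exact: ltW].
apply: negligibleU.
  have [[y [Sy My]]|/forallNP M0] := pselect (exists y, M y).
    apply: negligibleS (H y Sy) => z [Sz Mz]; split => //=; exact: My.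
  by rewrite (_ : M = set0); [exact: negligible_set0|apply/seteqP; split => // x /M0].
apply: negligible_bigcup_rat => q.
have [[x Sx xq]|H0] := pselect (exists2 x, S x & u x <= ratr q).
  apply: negligibleS (H x Sx) => y [Sy [qy _]]; split => //=.
  exact: le_trans xq qy.
by apply: negligibleS (negligible_set0 mu) => y [_ [_ /H0]].
Qed.

(** The hypothesis says that [G] and [u] are similarly ordered. The value of the
    monotone function at [t] is the essential infimum of [G] over the
    superlevel set [u >= t], clamped to [lo, hi]. *)
Lemma ae_nondecreasing_factor (Omega : set T) (u G : T -> R) (lo hi : \bar R) :
  (forall c t, mu.-negligible (Omega `&` [set x | u x <= t /\ c < G x]) \/
               mu.-negligible (Omega `&` [set x | t <= u x /\ G x < c])) ->
  (lo <= hi)%E ->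
  {ae mu, forall x, Omega x -> (lo <= (G x)%:E <= hi)%E} ->
  exists phi : R -> \bar R, [/\ nondecreasing_fun phi,
    forall t, (lo <= phi t <= hi)%E &
    {ae mu, forall x, Omega x -> (G x)%:E = phi (u x)}].
Proof.
move=> H lohi aeG.
pose low c t := mu.-negligible (Omega `&` [set x | t <= u x /\ G x < c]).
pose up c t := mu.-negligible (Omega `&` [set x | u x <= t /\ c < G x]).
pose s t := ereal_sup [set c%:E | c in low ^~ t].
pose phi t := Order.max lo (Order.min hi (s t)).
(* [s (u x) <= G x]: no rational bound [q > G x] is admissible at [u x]. *)
have ae_low : {ae mu, forall x, forall q : rat,
    Omega x -> low (ratr q) (u x) -> ~ (G x < ratr q)}.
  apply: ae_rat => q.
  pose S := ~` [set x | Omega x -> low (ratr q) (u x) -> ~ (G x < ratr q)].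
  have SE x : S x -> [/\ Omega x, low (ratr q) (u x) & G x < ratr q].
    by move=> /not_implyP[Ox /not_implyP[lx /contrapT Gx]].
  change (mu.-negligible S).
  apply: (@negligible_superlevels u) => x /SE[_ + _]; apply: negligibleS.
  by move=> y [/SE[Oy _ Gy] xy].
(* [G x <= s (u x)], since by [H] a level [q < G x] that is not [up] is [low]. *)
have ae_up : {ae mu, forall x, forall q : rat,
    Omega x -> up (ratr q) (u x) -> ~ (ratr q < G x)}.
  apply: ae_rat => q.
  pose S := ~` [set x | Omega x -> up (ratr q) (u x) -> ~ (ratr q < G x)].
  have SE x : S x -> [/\ Omega x, up (ratr q) (u x) & ratr q < G x].
    by move=> /not_implyP[Ox /not_implyP[lx /contrapT Gx]].
  change (mu.-negligible S).
  apply: (@negligible_superlevels (\- u)) => x /SE[_ + _]; apply: negligibleS.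
  by move=> y [/SE[Oy _ Gy] /=]; rewrite lerN2.
exists phi; split.
- move=> t t' tt'; rewrite /phi.
  have st : (s t <= s t')%E.
    apply: ereal_sup_le => _ [c lc <-]; exists c => //.
    apply: negligibleS lc => x [Ox [t'x Gx]]; split => //; split => //.
    exact: le_trans t'x.
  by rewrite le_max2// le_min2.
- move=> t; rewrite /phi le_max lexx/= ge_max lohi/=.
  by rewrite ge_min lexx.
apply: filterS3 aeG ae_low ae_up => x lG ll lu Ox.
have {lG}/andP[loG Ghi] := lG Ox.
suff -> : phi (u x) = Order.max lo (Order.min hi (G x)%:E).
  by rewrite (min_idPr Ghi) (max_idPr loG).
congr (Order.max _ (Order.min _ _)); apply/eqP; rewrite eq_le; apply/andP; split.
  apply: ge_ereal_sup => _ [c lc <-]; rewrite lee_fin leNgt; apply/negP => Gc.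
  have [q] := rat_in_itvoo Gc; rewrite in_itv/= => /andP[Gq qc].
  apply: (ll q) => //; apply: negligibleS lc => y [Oy [xy Gy]]; split => //.
  by split => //; exact: lt_trans qc.
rewrite leNgt; apply/negP => sG.
have [q sq qG] : exists2 q : rat, (s (u x) < (ratr q)%:E)%E & ratr q < G x.
  move: sG; case: (s (u x)) => [r| |]; last 2 first.
  - by rewrite ltNge leey.

  - have [q] : exists q, ratr q \in `](G x - 1), (G x)[.
      by apply: rat_in_itvoo; rewrite ltrBlDr ltrDl.
    by rewrite in_itv/= => /andP[_ qG] _; exists q => //; exact: ltNyr.
  rewrite lte_fin => /rat_in_itvoo[q]; rewrite in_itv/= => /andP[rq qG].
  by exists q.
have [upq|lowq] := H (ratr q) (u x); first exact: (lu q).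
suff : ((ratr q)%:E <= s (u x))%E by rewrite leNgt sq.
by apply: ereal_sup_ubound; exists (ratr q).
Qed.

End negligible_families.

(** * Separation by the level sets of a function *)

Section separation.
Context d (T : measurableType d) (R : realType).
Variable mu : {sigma_finite_measure set T -> \bar R}.

(** In the product of [A] and [B] the pairs of points at the same level are null,
    and every other pair is separated by one of countably many rational
    thresholds. *)
Lemma separating_threshold (c : T -> R) (A B : set T) :
  measurable_fun setT c -> (forall k, mu [set x | c x = k] = 0%E) ->
  measurable A -> measurable B -> (0 < mu A)%E -> (0 < mu B)%E ->
  exists e k : R,
    (0 < mu (A `&` [set x | (0 < e * (c x - k))%R]))%E /\
    (0 < mu (B `&` [set x | (e * (c x - k) < 0)%R]))%E.
Proof.
move=> mc c0 mA mB A0 B0; apply: contrapT => H.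
pose Ap k := A `&` [set x | k < c x]; pose An k := A `&` [set x | c x < k].
pose Bp k := B `&` [set x | k < c x]; pose Bn k := B `&` [set x | c x < k].
have mp C k : measurable C -> measurable (C `&` [set x | k < c x]).
  move=> mC; apply: measurableI => //.
  rewrite -[X in measurable X]setTI (_ : mkset _ = c @^-1` `]k, +oo[%classic).
    exact: mc.
  by apply/seteqP; split => x /=; rewrite in_itv/= andbT.
have mn C k : measurable C -> measurable (C `&` [set x | c x < k]).
  move=> mC; apply: measurableI => //.
  rewrite -[X in measurable X]setTI (_ : mkset _ = c @^-1` `]-oo, k[%classic).
    exact: mc.
  by apply/seteqP; split => x /=; rewrite in_itv/=.
pose F q := Ap (ratr q) `*` Bn (ratr q).
pose G q := An (ratr q) `*` Bp (ratr q).
pose E := [set z : T * T | c z.1 = c z.2].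
have mE : measurable E.
  rewrite (_ : E = (fun z : T * T => c z.1 - c z.2) @^-1` [set 0]).
    rewrite -[X in measurable X]setTI.
    have mcB : measurable_fun setT (fun z : T * T => c z.1 - c z.2).
      by apply: measurable_funB; apply: measurableT_comp.
    exact: mcB.
  apply/seteqP; split => z /=; rewrite /E/=; first by move=> ->; rewrite subrr.
  by move=> /eqP; rewrite subr_eq0 => /eqP.
have mu2E (C D : set T) : measurable C -> measurable D ->
    (mu C = 0 \/ mu D = 0)%E -> (mu \x mu)%E.-negligible (C `*` D).
  move=> mC mD CD; exists (C `*` D); split => //; first exact: measurableX.
  transitivity (mu C * mu D)%E; first exact: product_measure1E.
  by case: CD => ->; rewrite ?mul0e ?mule0.
have dic (C D : set T) : measurable C -> measurable D ->
    ~ ((0 < mu C)%E /\ (0 < mu D)%E) -> (mu C = 0 \/ mu D = 0)%E.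
  move=> mC mD; rewrite !lt0e !measure_ge0 !andbT => CD.
  have [->|C0] := eqVneq (mu C) 0%E; [by left|right].
  by apply/eqP/negP => /negP D0; apply: CD.
have : (mu \x mu)%E.-negligible (A `*` B).
  apply: (@negligibleS _ _ _ _ ((\bigcup_q F q) `|` (\bigcup_q G q) `|` E)).
    move=> [x y] [/= Ax By].
    have [xy|xy|xy] := ltgtP (c x) (c y); last by right.
      have [q] := rat_in_itvoo xy; rewrite in_itv/= => /andP[xq qy].
      by left; right; exists q.
    have [q] := rat_in_itvoo xy; rewrite in_itv/= => /andP[xq qy].
    by left; left; exists q.
  apply: negligibleU; first apply: negligibleU.
  - apply: negligible_bigcup_rat => q; apply: mu2E; [exact: mp|exact: mn|].
    apply: dic; [exact: mp|exact: mn|] => -[Aq Bq]; apply: H.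
    exists 1, (ratr q); split.
      move: Aq; congr (_ < mu _)%E; apply/seteqP.
      by split => x [/= ?]; rewrite /= mul1r subr_gt0.
    move: Bq; congr (_ < mu _)%E; apply/seteqP.
    by split => x [/= ? ]; rewrite /= mul1r subr_lt0.
  - apply: negligible_bigcup_rat => q; apply: mu2E; [exact: mn|exact: mp|].
    apply: dic; [exact: mn|exact: mp|] => -[Aq Bq]; apply: H.
    exists (-1), (ratr q); split.
      move: Aq; congr (_ < mu _)%E; apply/seteqP.
      by split => x [/= ?]; rewrite /= mulN1r oppr_gt0 subr_lt0.
    move: Bq; congr (_ < mu _)%E; apply/seteqP.
    by split => x [/= ?]; rewrite /= mulN1r oppr_lt0 subr_gt0.
  exists E; split => //.
  transitivity (\int[mu]_x mu (xsection E x))%E; first by [].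
  rewrite integral0_eq// => x _.
  rewrite -[RHS](c0 (c x)); congr (mu _).
  by apply/seteqP; split => y; rewrite xsectionE /= /E /=.
move=> /(measure_negligible (measurableX mA mB)) AB0.
have : (mu A * mu B = 0)%E by rewrite -AB0; exact/esym/product_measure1E.
by apply/eqP; rewrite mule_neq0// gt_eqF.
Qed.

End separation.

(** * Equimeasurable functions *)

Section equimeasurable.
Context d (T : measurableType d) (R : realType).
Variables (mu : {measure set T -> \bar R}) (Omega : set T).
Hypotheses (mOmega : measurable Omega) (Omega_fin : (mu Omega < +oo)%E).
Variables f h : T -> R.
Hypotheses (mf : measurable_fun Omega f) (mh : measurable_fun Omega h).
Hypothesis fh : forall t : R, mu (Omega `&` [set x | t < h x]) =
                              mu (Omega `&` [set x | t < f x]).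

(** Half-lines form a pi-system generating the Borel sets, and finiteness of
    [mu Omega] makes the two image measures finite. *)
Lemma equimeasurable_preimage (Y : set (measurableTypeR R)) : measurable Y ->
  mu (Omega `&` h @^-1` Y) = mu (Omega `&` f @^-1` Y).
Proof.
have mr (k : T -> R) : measurable_fun Omega k ->
    measurable_fun setT (k \_ Omega : T -> measurableTypeR R).
  by move=> mk; apply/(measurable_restrictT k mOmega).
have rE (k : T -> R) Z : mrestr mu mOmega ((k \_ Omega) @^-1` Z) = mu (Omega `&` k @^-1` Z).
  rewrite /mrestr; congr (mu _); apply/seteqP; split => x /=.
    by move=> [+ Ox]; rewrite patchE mem_set.
  by move=> [Ox ?]; rewrite patchE mem_set.
move=> mY; rewrite -!rE.
pose mH := image_measure (mrestr mu mOmega) (mr h mh).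
pose mF := image_measure (mrestr mu mOmega) (mr f mf).
change (mH Y = mF Y).
pose G : set (set (measurableTypeR R)) :=
  [set A | exists x : R, A = `]x, +oo[%classic].
pose g n : set (measurableTypeR R) := `](- n%:R)%R, +oo[%classic.
apply: (@measure_unique _ R (measurableTypeR R) G g _ _ _ _ mH mF) => //.
- exact: RGenOInfty.measurableE.
- move=> _ _ [x ->] [y ->]; exists (Num.max x y).
  apply/seteqP; split => z /=; rewrite !in_itv/= !andbT gt_max.
    by move=> [-> ->].
  by move=> /andP[].
- by move=> n; exists (- n%:R).
- apply/seteqP; split => // x _; exists (Num.truncn (- x)).+1 => //=.
  by rewrite /g /= in_itv/= andbT ltrNl; exact: truncnS_gt.
- move=> _ [x ->]; rewrite [LHS]rE [RHS]rE.
  have E (k : T -> R) : k @^-1` `]x, +oo[ = [set t | x < k t].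
    by apply/seteqP; split => t /=; rewrite in_itv/= andbT.
  by rewrite !E fh.
- move=> k; rewrite [ltLHS]rE.
  apply: le_lt_trans Omega_fin; apply: le_measure; rewrite ?inE//.
  by apply: mh => //; rewrite /g; exact: measurable_itv.
Qed.

(** Since [F 0 = 0], the complement of [Omega], which may have infinite measure,
    does not contribute. *)
Lemma equimeasurable_integral (F : R -> \bar R) :
  measurable_fun setT F -> (forall y, 0 <= F y)%E -> F 0 = 0%E ->
  (\int[mu]_x F ((h \_ Omega) x) = \int[mu]_x F ((f \_ Omega) x))%E.
Proof.
move=> mF F0 F00.
have mr (k : T -> R) : measurable_fun Omega k ->
    measurable_fun setT (k \_ Omega : T -> measurableTypeR R).
  by move=> mk; apply/(measurable_restrictT k mOmega).
pose D : set (measurableTypeR R) := ~` [set 0].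
have mD : measurable D by exact: measurableC.
have E (k : T -> R) (mk : measurable_fun Omega k) :
    (\int[mu]_x F ((k \_ Omega) x) =
     \int[image_measure mu (mr k mk)]_(y in D) F y)%E.
  rewrite (@ge0_integral_pushforward _ _ _ _ _ _ (mr k mk) mu D F)//; last first.
    exact: measurable_funTS.
  rewrite [RHS]integral_mkcond; apply: eq_integral => x _.
  rewrite [RHS]patchE; case: ifPn => // xD.
  have -> : (k \_ Omega) x = 0; last by [].
  by apply: contrapT => k0; move/negP: xD; apply; exact/mem_set.
rewrite (E h mh) (E f mf); apply: eq_measure_integral => A mA AD.
rewrite /image_measure /= /pushforward.
have rE (k : T -> R) : (k \_ Omega) @^-1` A = Omega `&` k @^-1` A.
  apply/seteqP; split => x /=; rewrite patchE.
    case: ifPn => [/set_mem Ox|_]; first by split.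
    by move=> /AD/(_ erefl).
  by move=> [Ox]; rewrite mem_set.
by rewrite !rE; exact: equimeasurable_preimage.
Qed.

Lemma equimeasurable_ae (Y : set (measurableTypeR R)) : measurable Y ->
  {ae mu, forall x, Omega x -> Y (f x)} -> {ae mu, forall x, Omega x -> Y (h x)}.
Proof.
move=> mY.
have mk (k : T -> R) : measurable_fun Omega k -> measurable (Omega `&` k @^-1` (~` Y)).
  by move=> mk; apply: mk => //; exact: measurableC.
have E (k : T -> R) : ~` [set x | Omega x -> Y (k x)] = Omega `&` k @^-1` (~` Y).
  apply/seteqP; split => x /=; first by move/not_implyP.
  by move=> [Ox Yk] /(_ Ox).
move=> fY; change (mu.-negligible (~` [set x | Omega x -> Y (h x)])).
have : mu.-negligible (~` [set x | Omega x -> Y (f x)]) by [].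
rewrite !E => /(measure_negligible (mk f mf)) m0.
exists (Omega `&` h @^-1` (~` Y)); split => //; first exact: mk.
by rewrite equimeasurable_preimage//; exact: measurableC.
Qed.

End equimeasurable.

(** * The Gagliardo energy *)

Section energy.
Context {R : realType} {N : nat}.
Local Notation mu := (@sf_lebesgue_rV R N).
Implicit Types (s : R) (u v w : 'rV[R]_N -> R) (x y z : 'rV[R]_N).

Definition first_coord x : R := \sum_(i < N | val i == 0%N) x ord0 i.

Definition riesz s z : R := (enorm z `^ (N%:R + 2 * s))^-1.

(** The square of the Gagliardo seminorm. *)
Definition energy s u : \bar R :=
  (\int[mu]_x \int[mu]_y (`|u x - u y| ^+ 2 * riesz s (x - y))%:E)%E.

Lemma measurable_first_coord : measurable_fun setT first_coord.
Proof.
rewrite /first_coord; under eq_fun do rewrite -big_filter.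
by apply: measurable_sum => i; exact: measurable_rV_coord.
Qed.

Lemma measurable_enorm : measurable_fun setT (@enorm R N).
Proof.
have msqrt : measurable_fun setT (@Num.sqrt R).
  by apply: continuous_measurable_fun; exact: sqrt_continuous.
apply: (measurableT_comp msqrt).
apply: measurable_sum => i; apply: measurable_funX.
exact: measurable_rV_coord.
Qed.

Lemma measurable_riesz s : measurable_fun setT (riesz s).
Proof.
rewrite (_ : riesz s = fun z => enorm z `^ (- (N%:R + 2 * s))); last first.
  by apply/funext => z; rewrite powRN.
exact: (measurableT_comp (measurable_powR _) measurable_enorm).
Qed.

Lemma riesz_ge0 s z : 0 <= riesz s z.
Proof. by rewrite invr_ge0 powR_ge0. Qed.

Lemma enormN z : enorm (- z) = enorm z.
Proof. by rewrite /enorm; congr Num.sqrt; apply: eq_bigr => i _; rewrite mxE sqrrN. Qed.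

Lemma measurable_subrV :
  measurable_fun setT (fun p : 'rV[R]_N * 'rV[R]_N => p.1 - p.2).
Proof.
apply: measurable_rVP => i; under eq_fun do rewrite !mxE.
apply: measurable_funB.
  exact: (measurableT_comp (measurable_rV_coord i) measurable_fst).
exact: (measurableT_comp (measurable_rV_coord i) measurable_snd).
Qed.

Definition energy_density s u (p : 'rV[R]_N * 'rV[R]_N) : R :=
  `|u p.1 - u p.2| ^+ 2 * riesz s (p.1 - p.2).

Lemma energy_density_ge0 s u p : 0 <= energy_density s u p.
Proof. by rewrite mulr_ge0 ?riesz_ge0// exprn_ge0. Qed.

Lemma measurable_energy_density s u : measurable_fun setT u ->
  measurable_fun setT (energy_density s u).
Proof.
move=> mfu; apply: measurable_funM; last first.
  exact: (measurableT_comp (measurable_riesz s) measurable_subrV).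
apply: measurable_funX; apply: measurableT_comp => //; apply: measurable_funB.
  exact: (measurableT_comp mfu measurable_fst).
exact: (measurableT_comp mfu measurable_snd).
Qed.

Lemma energyE s u : measurable_fun setT u ->
  energy s u = (\int[mu \x mu]_p (energy_density s u p)%:E)%E.
Proof.
move=> mfu; apply/esym; apply: fubini_tonelli1.
  by apply/measurable_EFinP; exact: measurable_energy_density.
by move=> p; rewrite lee_fin energy_density_ge0.
Qed.

Lemma energy_ge0 s u : (0 <= energy s u)%E.
Proof.
apply: integral_ge0 => x _; apply: integral_ge0 => y _.
by rewrite lee_fin mulr_ge0 ?riesz_ge0// exprn_ge0.
Qed.

Lemma energyZ s u (c : R) : measurable_fun setT u ->
  energy s (fun x => c * u x) = ((c ^+ 2)%:E * energy s u)%E.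
Proof.
move=> mfu; rewrite !energyE//; last exact: measurable_funM.
rewrite -ge0_integralZl_EFin//; last 3 first.
- by move=> p _; rewrite lee_fin energy_density_ge0.
- by apply/measurable_EFinP; exact: measurable_energy_density.
- exact: sqr_ge0.
apply: eq_integral => p _; rewrite -EFinM; congr EFin.
by rewrite /energy_density !real_normK ?num_real//; ring.
Qed.

(** The parallelogram law holds pointwise between nonnegative densities, so the
    identity extends to infinite energies. *)
Lemma energy_parallelogram s u v :
  measurable_fun setT u -> measurable_fun setT v ->
  (energy s (fun x => u x + v x)%R + energy s (fun x => u x - v x)%R =
   2%:E * energy s u + 2%:E * energy s v)%E.
Proof.
move=> mfu mv.
have md w : measurable_fun setT w ->
    measurable_fun setT (EFin \o energy_density s w).
  by move=> mw; apply/measurable_EFinP; exact: measurable_energy_density.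
have d0 w p : (0 <= (EFin \o energy_density s w) p)%E.
  by rewrite lee_fin energy_density_ge0.
have muv := measurable_funD mfu mv; have muv' := measurable_funB mfu mv.
have d0' w (p : 'rV[R]_N * 'rV[R]_N) : setT p -> (0 <= (EFin \o energy_density s w) p)%E.
  by move=> _; exact: d0.
rewrite !energyE// -(ge0_integralD _ measurableT (d0' _) (md _ muv) (d0' _) (md _ muv')).
rewrite -!ge0_integralZl_EFin//; [|exact: d0'|exact: md|exact: d0'|exact: md].
rewrite -ge0_integralD//; last 4 first.
- by move=> p _; rewrite mule_ge0// ?lee_fin ?energy_density_ge0.
- by apply: measurable_funeM; exact: md.
- by move=> p _; rewrite mule_ge0// ?lee_fin ?energy_density_ge0.
- by apply: measurable_funeM; exact: md.
apply: eq_integral => p _; rewrite -!EFinM -!EFinD; congr EFin.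
rewrite /energy_density /= !real_normK ?num_real//.
by ring.
Qed.

(** Leibniz rule: [u x * w x - u y * w y] is
    [w y * (u x - u y) + u x * (w x - w y)]. *)
Lemma energy_mul_le s u w (M : R) (J : \bar R) :
  measurable_fun setT u -> measurable_fun setT w ->
  (forall x, `|w x| <= M) -> (0 <= J)%E ->
  (forall x, \int[mu]_y (`|w x - w y| ^+ 2 * riesz s (x - y))%:E <= J)%E ->
  (energy s (fun x => u x * w x)%R <=
   (2 * M ^+ 2)%:E * energy s u + 2%:E * (J * \int[mu]_x (u x ^+ 2)%:E))%E.
Proof.
move=> mfu mw wM J0 wJ.
have muw : measurable_fun setT (fun x => u x * w x) by exact: measurable_funM.
have mdu := measurable_energy_density s mfu.
have mdw := measurable_energy_density s mw.
pose B (p : 'rV[R]_N * 'rV[R]_N) := u p.1 ^+ 2 * energy_density s w p.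
have mB : measurable_fun setT B.
  apply: measurable_funM => //; apply: measurable_funX.
  exact: (measurableT_comp mfu measurable_fst).
have B0 p : 0 <= B p by rewrite mulr_ge0 ?sqr_ge0 ?energy_density_ge0.
have pw p : energy_density s (fun x => u x * w x) p <=
    2 * M ^+ 2 * energy_density s u p + 2 * B p.
  rewrite /B /energy_density !real_normK ?num_real//.
  move: (riesz _ _) (riesz_ge0 s (p.1 - p.2)) => K K0.
  have /lerXn2r : `|w p.2| <= M by [].
  move=> /(_ 2%N); rewrite !nnegrE normr_ge0 (le_trans (normr_ge0 _) (wM p.2)).
  move=> /(_ isT isT); rewrite real_normK ?num_real// => wM2.
  set a := u p.1; set b := u p.2; set c := w p.1; set d := w p.2 in wM2 *.
  have -> : a * c - b * d = d * (a - b) + a * (c - d) by ring.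
  have -> : 2 * M ^+ 2 * ((a - b) ^+ 2 * K) + 2 * (a ^+ 2 * ((c - d) ^+ 2 * K)) =
    (2 * (M ^+ 2 * (a - b) ^+ 2) + 2 * (a * (c - d)) ^+ 2) * K by ring.
  rewrite ler_wpM2r//.
  apply: (@le_trans _ _ (2 * (d * (a - b)) ^+ 2 + 2 * (a * (c - d)) ^+ 2)).
    have : 0 <= (d * (a - b) - a * (c - d)) ^+ 2 by exact: sqr_ge0.
    by move: (d * _) (a * _) => X Y; rewrite sqrrB sqrrD; lra.
  by rewrite lerD2r ler_pM2l// exprMn ler_wpM2r// sqr_ge0.
rewrite !energyE//.
apply: (@le_trans _ _ (\int[mu \x mu]_p
   ((2 * M ^+ 2)%:E * (energy_density s u p)%:E + 2%:E * (B p)%:E))%E).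
  apply: ge0_le_integral => //.
  - by move=> p _; rewrite lee_fin energy_density_ge0.
  - by apply/measurable_EFinP; exact: measurable_energy_density.
  - by apply: emeasurable_funD; apply: measurable_funeM; apply/measurable_EFinP.
  - by move=> p _; rewrite -!EFinM -EFinD lee_fin.
have M20 : 0 <= 2 * M ^+ 2 by rewrite mulr_ge0// sqr_ge0.
rewrite ge0_integralD//; last 4 first.
- by move=> p _; rewrite mule_ge0// lee_fin// energy_density_ge0.
- by apply: measurable_funeM; exact/measurable_EFinP.
- by move=> p _; rewrite mule_ge0// lee_fin.
- by apply: measurable_funeM; exact/measurable_EFinP.
rewrite !ge0_integralZl_EFin//; last 4 first.
- by move=> p _; rewrite lee_fin.
- exact/measurable_EFinP.
- by move=> p _; rewrite lee_fin energy_density_ge0.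
- exact/measurable_EFinP.
apply: leeD => //; rewrite lee_pmul2l//.
rewrite (fubini_tonelli1 (m1 := mu) (m2 := mu))//; last exact/measurable_EFinP.
rewrite -ge0_integralZl//; last 2 first.
- by apply/measurable_EFinP; exact: measurable_funX.
- by move=> x _; rewrite lee_fin sqr_ge0.
apply: ge0_le_integral => //.
- by move=> x _; apply: integral_ge0 => y _; rewrite lee_fin.
- apply: measurable_fun_fubini_tonelli_F; first exact/measurable_EFinP.
  by move=> p; rewrite lee_fin.
- by apply: measurable_funeM; apply/measurable_EFinP; exact: measurable_funX.
move=> x _; rewrite muleC /fubini_F /B /=.
under eq_integral do rewrite EFinM.
rewrite ge0_integralZl_EFin//.
- by rewrite lee_wpmul2l// ?lee_fin ?sqr_ge0//; exact: wJ.
- by move=> y _; rewrite lee_fin energy_density_ge0.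
- apply/measurable_EFinP.
  exact: (measurable_fun_pair2 x mdw).
- exact: sqr_ge0.
Qed.

Lemma first_coordB x y : first_coord (x - y) = first_coord x - first_coord y.
Proof.
rewrite /first_coord -sumrB; apply: eq_bigr => i _.
by rewrite !mxE.
Qed.

Lemma first_coordN x : first_coord (- x) = - first_coord x.
Proof. by rewrite -[- x]add0r first_coordB /first_coord big1 ?add0r// => i _; rewrite mxE. Qed.

(** The square of the distance between two points of the unit circle is
    [2 * (1 - cos (a - b))], and the cosines differ by less. *)
Lemma cosB_sqr_le (a b : R) : (cos a - cos b) ^+ 2 <= 2 * (1 - cos (a - b)).
Proof.
have := sqr_ge0 (sin a - sin b); rewrite cosB.
have := cos2Dsin2 a; have := cos2Dsin2 b.
rewrite !sqrrB; lra.
Qed.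

(** The factor [e] is there to choose the sign. *)
Definition cos_weight (e k : R) x : R := e * (cos (first_coord x) - k).

Lemma measurable_cos_first_coord : measurable_fun setT (fun x => cos (first_coord x)).
Proof.
have mcos : measurable_fun setT (@cos R).
  by apply: continuous_measurable_fun; exact: continuous_cos.
exact: (measurableT_comp mcos measurable_first_coord).
Qed.

Lemma measurable_cos_weight e k : measurable_fun setT (cos_weight e k).
Proof.
apply: measurable_funM => //; apply: measurable_funB => //.
exact: measurable_cos_first_coord.
Qed.

Lemma cos_weight_le e k x : `|cos_weight e k x| <= `|e| * (1 + `|k|).
Proof.
rewrite /cos_weight normrM ler_wpM2l//; apply: le_trans (ler_normB _ _) _.
by rewrite lerD2r cos_max.
Qed.

(** After translation, the difference quotients of the cosine are dominated by
    the integrand defining the normalization constant of the fractional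
    Laplacian. *)
Lemma cos_weight_quotient s e k x :
  (\int[mu]_y (`|cos_weight e k x - cos_weight e k y| ^+ 2 * riesz s (x - y))%:E <=
   (2 * e ^+ 2)%:E * \int[mu]_z ((1 - cos (first_coord z)) * riesz s z)%:E)%E.
Proof.
pose f z : R := (1 - cos (first_coord z)) * riesz s z.
have f0 z : 0 <= f z by rewrite mulr_ge0 ?riesz_ge0// subr_ge0 cos_le1.
have mf : measurable_fun setT f.
  apply: measurable_funM; last exact: measurable_riesz.
  by apply: measurable_funB => //; exact: measurable_cos_first_coord.
have msh := @measurable_rV_shift R N (- x).
have <- : (\int[mu]_y (f (y - x)%R)%:E = \int[mu]_z (f z)%:E)%E.
  apply: (@ge0_integral_preserved _ _ _ mu _ msh _ (EFin \o f)).
  - by move=> A mA; exact: lebesgue_rV_shift.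
  - exact/measurable_EFinP.
  - by move=> z; rewrite lee_fin.
have mfx : measurable_fun setT (fun y => f (y - x)) by exact: (measurableT_comp mf msh).
rewrite -ge0_integralZl_EFin//; last 3 first.
- by move=> y _; rewrite lee_fin.
- exact/measurable_EFinP.
- by rewrite mulr_ge0// sqr_ge0.
apply: ge0_le_integral => //.
- by move=> y _; rewrite lee_fin mulr_ge0 ?riesz_ge0// exprn_ge0.
- apply/measurable_EFinP.
  exact: (measurable_fun_pair2 x (measurable_energy_density s (measurable_cos_weight e k))).
- by apply: measurable_funeM; exact/measurable_EFinP.
move=> y _; rewrite -EFinM lee_fin /f.
have -> : y - x = - (x - y) by rewrite opprB.
rewrite first_coordN cosN /riesz enormN -/(riesz s (x - y)) mulrA.
rewrite ler_wpM2r ?riesz_ge0// real_normK ?num_real// /cos_weight first_coordB.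
have := cosB_sqr_le (first_coord x) (first_coord y).
have -> : e * (cos (first_coord x) - k) - e * (cos (first_coord y) - k) =
  e * (cos (first_coord x) - cos (first_coord y)) by ring.
rewrite exprMn; move: (cos (_ - _)) (cos _ - _) => a b ab.
have -> : 2 * e ^+ 2 * (1 - a) = e ^+ 2 * (2 * (1 - a)) by ring.
by rewrite ler_wpM2l// sqr_ge0.
Qed.

End energy.

(** * Hoelder's inequality for weights *)

Section lebesgue_norms.
Context {R : realType} {N : nat}.
Local Notation mu := (@sf_lebesgue_rV R N).
Implicit Types (q s C : R) (Omega : set 'rV[R]_N) (f g u V w : 'rV[R]_N -> R).

Lemma norm_LpE Omega (p : R) f :
  norm_Lp Omega p%:E f = ((\int[mu]_x (`|(f \_ Omega) x| `^ p)%:E) `^ p^-1)%E.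
Proof. by rewrite /norm_Lp unlock. Qed.

Lemma eq_norm_Lp Omega (p : R) f g :
  (\int[mu]_x (`|(f \_ Omega) x| `^ p)%:E =
   \int[mu]_x (`|(g \_ Omega) x| `^ p)%:E)%E ->
  norm_Lp Omega p%:E f = norm_Lp Omega p%:E g.
Proof. by move=> fg; rewrite !norm_LpE fg. Qed.

Lemma norm_Lp_lty Omega (p : R) f : 0 < p ->
  (norm_Lp Omega p%:E f < +oo)%E ->
  (\int[mu]_x (`|(f \_ Omega) x| `^ p)%:E < +oo)%E.
Proof.
by move=> p0; rewrite norm_LpE; apply: lty_poweRy; rewrite invr_neq0// gt_eqF.
Qed.

Lemma in_L2P u : in_Lp setT 2%:E u <->
  measurable_fun setT u /\ (\int[mu]_x (u x ^+ 2)%:E < +oo)%E.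
Proof.
have E : (\int[mu]_x (`|(u \_ setT) x| `^ 2)%:E = \int[mu]_x (u x ^+ 2)%:E)%E.
  apply: eq_integral => x _; congr EFin.
  by rewrite patchE in_setT powR_mulrn// real_normK ?num_real.
split=> -[mfu u2]; split => //.
  by rewrite -E; exact: norm_Lp_lty u2.
by rewrite norm_LpE E poweR_lty.
Qed.

Lemma conj_exp_gt0 q : 1 < q -> 0 < conj_exp q.
Proof. by move=> q1; rewrite divr_gt0 ?subr_gt0// (lt_trans ltr01). Qed.

(** Hoelder's inequality with exponents [q] and [q'], as the [L^q'] norm of
    [u ^ 2] is the square of the [L^(2 q')] norm of [u]. *)
Lemma hoelder_weight Omega q V u : measurable Omega -> 1 < q ->
  measurable_fun Omega V -> measurable_fun Omega u ->
  (\int[mu]_(x in Omega) `|V x * `|u x| ^+ 2|%:E <=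
   norm_Lp Omega q%:E V * norm_Lp Omega (2 * conj_exp q)%:E u `^ 2)%E.
Proof.
move=> mO q1 mV mfu.
have q0 : 0 < q by exact: lt_trans q1.
have q'0 := conj_exp_gt0 q1.
have mVr : measurable_fun setT (V \_ Omega) by apply/(measurable_restrictT _ mO).
have mur : measurable_fun setT (u \_ Omega) by apply/(measurable_restrictT _ mO).
have mu2 : measurable_fun setT (fun x => `|(u \_ Omega) x| ^+ 2).
  by apply: measurable_funX; exact: measurableT_comp.
have qq : q^-1 + (conj_exp q)^-1 = 1.
  by rewrite /conj_exp; field; rewrite !gt_eqF// subr_gt0.
have := hoelder mu mVr mu2 q0 q'0 qq.
rewrite Lnorm1; congr (_ <= _ * _)%E.
- rewrite [RHS]integral_mkcond; apply: eq_integral => x _ /=.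
  by rewrite !patchE; case: ifP => //; rewrite /point/= mul0r normr0.
- by rewrite unlock norm_LpE.
- rewrite unlock norm_LpE -poweRrM.
  have -> : (2 * conj_exp q)^-1 * 2 = (conj_exp q)^-1 by field; rewrite gt_eqF.
  have E : (\int[mu]_x `|(`|(u \_ Omega) x| ^+ 2)%:E| `^ conj_exp q =
      \int[mu]_x (`|(u \_ Omega) x| `^ (2 * conj_exp q))%:E)%E.
    apply: eq_integral => x _; rewrite /=; congr EFin.
    by rewrite ger0_norm ?exprn_ge0// -powR_mulrn// -powRrM.
  by rewrite E.
Qed.

End lebesgue_norms.

(** * A rearrangement inequality *)

Section invariant_domain.
Context d (T : measurableType d) (R : realType).
Variables (mu : {measure set T -> \bar R}) (phi : T -> T) (D : set T).
Hypothesis mphi : measurable_fun setT phi.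
Hypothesis phi_mu : forall A, measurable A -> mu (phi @^-1` A) = mu A.
Hypothesis mD : measurable D.
Hypothesis phiD : forall x, D (phi x) <-> D x.

Let restrict_comp (f : T -> R) : (f \o phi) \_ D = (f \_ D) \o phi.
Proof.
apply/funext => x; rewrite /= !patchE.
have -> : (phi x \in D) = (x \in D) by apply/idP/idP => /set_mem/phiD/mem_set.
by [].
Qed.

Lemma integrable_preserved_in (f : T -> R) :
  mu.-integrable D (EFin \o f) -> mu.-integrable D (EFin \o (f \o phi)).
Proof.
move=> /(integrable_mkcond _ mD) fi; apply/(integrable_mkcond _ mD).
rewrite restrict_EFin restrict_comp; apply: integrable_preserved => //.
by rewrite -restrict_EFin.
Qed.

Lemma Rintegral_preserved_in (f : T -> R) :
  mu.-integrable D (EFin \o f) ->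
  \int[mu]_(x in D) f (phi x) = \int[mu]_(x in D) f x.
Proof.
move=> /(integrable_mkcond _ mD) fi.
rewrite [LHS]Rintegral_mkcond [RHS]Rintegral_mkcond.
rewrite (_ : (fun x => f (phi x)) \_ D = (f \_ D) \o phi); last exact: restrict_comp.
apply: (@Rintegral_preserved _ _ _ mu phi mphi phi_mu (f \_ D)).
by rewrite -restrict_EFin.
Qed.

(** Change of variables by [phi] turns [(G \o phi) * f] into [G * (f \o phi)],
    and [G * f] into [(G \o phi) * (f \o phi)]. Hence twice the difference of
    the two integrals is the integral of
    [(G \o phi - G) * (f - f \o phi)]. *)
Lemma involution_integral_le (G f : T -> R) :
  involutive phi ->
  mu.-integrable D (EFin \o (fun x => G x * f x)) ->
  mu.-integrable D (EFin \o (fun x => G (phi x) * f x)) ->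
  (forall x, D x -> 0 <= (G (phi x) - G x) * (f x - f (phi x))) ->
  \int[mu]_(x in D) (G x * f x) <= \int[mu]_(x in D) (G (phi x) * f x).
Proof.
move=> phiK i1 i2 H.
have i3 := integrable_preserved_in i1; have i4 := integrable_preserved_in i2.
have e3 := Rintegral_preserved_in i1; have e4 := Rintegral_preserved_in i2.
have : 0 <= \int[mu]_(x in D) ((G (phi x) * f x - G x * f x) +
  (G (phi (phi x)) * f (phi x) - G (phi x) * f (phi x))).
  apply: Rintegral_ge0 => x Dx; rewrite phiK; have := H x Dx.
  by congr (_ <= _); ring.
rewrite RintegralD//; last 2 first.
- exact: (integrableB mD i2 i1).
- exact: (integrableB mD i4 i3).
rewrite !RintegralB// e3 e4; lra.
Qed.

End invariant_domain.

(** * Stationarity of the Rayleigh quotient *)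

Section bounded_weights.
Context d (T : measurableType d) (R : realType).
Variables (mu : {measure set T -> \bar R}) (D : set T).
Hypothesis mD : measurable D.

Lemma integrable_mul_bounded (h w : T -> R) (M : R) :
  mu.-integrable D (EFin \o h) -> measurable_fun D w ->
  (forall x, `|w x| <= M) ->
  mu.-integrable D (EFin \o (fun x => h x * w x)).
Proof.
move=> ih mw wM.
have /integrableP[mh _] := ih.
apply: (@le_integrable _ _ _ _ _ mD _ (fun x => M%:E * `|(h x)%:E|)%E).
- by apply/measurable_EFinP/measurable_funM => //; apply/measurable_EFinP.
- move=> x _ /=; rewrite lee_fin normrM [leRHS]normrM normr_id mulrC.
  by rewrite ler_wpM2r//; exact: le_trans (wM x) (ler_norm _).
- by apply: integrableZl => //; exact: integrable_abse.
Qed.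

Lemma Rintegral_quadratic (h w : T -> R) (M t : R) :
  mu.-integrable D (EFin \o h) -> measurable_fun D w ->
  (forall x, `|w x| <= M) ->
  \int[mu]_(x in D) (h x * (1 + t * w x) ^+ 2) =
  \int[mu]_(x in D) h x + 2 * t * \int[mu]_(x in D) (h x * w x) +
    t ^+ 2 * \int[mu]_(x in D) (h x * w x * w x).
Proof.
move=> ih mw wM.
have i1 := integrable_mul_bounded ih mw wM.
have i2 := integrable_mul_bounded i1 mw wM.
have i1' : mu.-integrable D (EFin \o (fun x => 2 * t * (h x * w x))).
  exact: (integrableZl mD (2 * t) i1).
have i2' : mu.-integrable D (EFin \o (fun x => t ^+ 2 * (h x * w x * w x))).
  exact: (integrableZl mD (t ^+ 2) i2).
have i3 : mu.-integrable D (EFin \o (fun x => h x + 2 * t * (h x * w x))).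
  exact: (integrableD mD ih i1').
have <- := @RintegralZl _ _ _ mu D (fun x => h x * w x) (2 * t) mD i1.
have <- := @RintegralZl _ _ _ mu D (fun x => h x * w x * w x) (t ^+ 2) mD i2.
rewrite -RintegralD// -RintegralD//.
by apply: eq_Rintegral => x _; ring.
Qed.

End bounded_weights.

Section real_lemmas.
Context {R : realType}.

Lemma quadratic_gt0_near (a b c : R) : 0 < a ->
  exists2 t0, 0 < t0 & forall t, `|t| <= t0 -> 0 < a + 2 * t * b + t ^+ 2 * c.
Proof.
move=> a0; set k := 2 * `|b| + `|c| + 1.
have k0 : 0 < k by rewrite ltr_wpDl// addr_ge0// mulr_ge0.
exists (Num.min 1 (a / (2 * k))).
  by rewrite lt_min ltr01/= divr_gt0// mulr_gt0.
move=> t; rewrite le_min => /andP[t1 ta].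
have : `|2 * t * b + t ^+ 2 * c| <= `|t| * k.
  apply: le_trans (ler_normD _ _) _; rewrite !normrM (@ger0_norm _ 2)//.
  have : `|t| * `|t| * `|c| <= `|t| * `|c|.
    by rewrite ler_wpM2r// ler_piMr.
  rewrite /k; have := normr_ge0 t; nra.
have : `|t| * k <= a / 2.
  have -> : a / 2 = a / (2 * k) * k by field; rewrite gt_eqF.
  by rewrite ler_pM2r.
rewrite ler_norml => H /andP[+ _]; lra.
Qed.

Lemma linear_coef_eq0 (b c t0 : R) : 0 < t0 ->
  (forall t, `|t| <= t0 -> 0 <= 2 * t * b + t ^+ 2 * c) -> b = 0.
Proof.
move=> t00 H; apply/eqP; apply: contraT => b0.
(* At [t = - Num.sg b * r] the term of order one is [- 2 * r * `|b|], and the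
   quadratic term is at most [r * `|b|]. *)
pose r := Num.min t0 (`|b| / (`|c| + 1)).
have c0 : 0 < `|c| + 1 by rewrite ltr_wpDl.
have r0 : 0 < r by rewrite lt_min t00/= divr_gt0// normr_gt0.
have rc : r * `|c| <= `|b|.
  have : r <= `|b| / (`|c| + 1) by rewrite ge_min lexx orbT.
  by rewrite ler_pdivlMr// mulrDr mulr1 => h; apply: le_trans h; rewrite lerDl ltW.
have tr : `|- Num.sg b * r| <= t0.
  rewrite normrM normrN normr_sg b0 mul1r gtr0_norm//.
  by rewrite ge_min lexx.
have := H _ tr.
have -> : 2 * (- Num.sg b * r) * b = - (2 * r * `|b|).
  by rewrite [in RHS]normrEsg; ring.
rewrite exprMn sqrrN sqr_sg b0 mul1r => K.
have b1 : 0 < `|b| by rewrite normr_gt0.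
have := ler_norm c; nra.
Qed.

(** The arithmetic of the two-sided comparison in [stationarity_exchange]. *)
Lemma second_difference_ge0 (c X1 X2 E0 E1 t lam : R)
    (a b d p q r a' b' d' p' q' r' : R) :
  X1 + X2 = 2 * E0 + 2 * t ^+ 2 * E1 ->
  lam * (p + 2 * t * q + t ^+ 2 * r) <=
    c * X1 + (a + 2 * t * b + t ^+ 2 * d) ->
  lam * (p' + 2 * (- t) * q' + (- t) ^+ 2 * r') <=
    c * X2 + (a' + 2 * (- t) * b' + (- t) ^+ 2 * d') ->
  c * E0 + a <= lam * p -> c * E0 + a' <= lam * p' ->
  0 <= 2 * t * (b - lam * q - (b' - lam * q')) +
       t ^+ 2 * (2 * c * E1 + (d + d' - lam * (r + r'))).
Proof.
move=> EX; have : c * X1 + c * X2 = c * (2 * E0 + 2 * t ^+ 2 * E1).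
  by rewrite -mulrDr EX.
rewrite sqrrN; lra.
Qed.

End real_lemmas.

Section variation.
Context {R : realType} {N : nat}.
Local Notation mu := (@sf_lebesgue_rV R N).
Implicit Types (s lam : R) (Omega : set 'rV[R]_N) (g u V w : 'rV[R]_N -> R).

Lemma sqr_fine_gagliardo s u : fine (gagliardo s u) ^+ 2 = fine (energy s u).
Proof.
have -> : gagliardo s u = (energy s u `^ 2^-1)%E by [].
have /fine_ge0 E0 := energy_ge0 s u.
by rewrite fine_poweR powR12_sqrt// sqr_sqrtr.
Qed.

Lemma gagliardo_lty s u : (gagliardo s u < +oo)%E <-> (energy s u < +oo)%E.
Proof.
have -> : gagliardo s u = (energy s u `^ 2^-1)%E by [].
split; last exact: poweR_lty.
by apply: lty_poweRy; rewrite invr_neq0.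
Qed.

Lemma H0sP s Omega u : H0s s Omega u <->
  [/\ measurable_fun setT u, (\int[mu]_x (u x ^+ 2)%:E < +oo)%E,
      (energy s u < +oo)%E & ae_on (~` Omega) (fun x => u x = 0)].
Proof.
split=> [[/in_L2P[? ?] /gagliardo_lty ? ?]|[? ? ? ?]]; first by split.
by split => //; [apply/in_L2P|apply/gagliardo_lty].
Qed.

Lemma weight_sqrE Omega (h u : 'rV[R]_N -> R) :
  \int[lebesgue_rV N]_(x in Omega) (h x * `|u x| ^+ 2) =
  \int[mu]_(x in Omega) (h x * u x ^+ 2).
Proof. by apply: eq_Rintegral => x _; rewrite real_normK ?num_real. Qed.

Lemma rayleighE s Omega g V u : rayleigh s Omega g V u =
  (fracC N s / 2 * fine (energy s u) + \int[mu]_(x in Omega) (V x * u x ^+ 2))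
  / \int[mu]_(x in Omega) (g x * u x ^+ 2).
Proof. by rewrite /rayleigh sqr_fine_gagliardo !weight_sqrE. Qed.

Lemma admissibleE s Omega g u : admissible s Omega g u <->
  H0s s Omega u /\ 0 < \int[mu]_(x in Omega) (g x * u x ^+ 2).
Proof. by rewrite /admissible weight_sqrE. Qed.

Section test_direction.
Variables (s M : R) (Omega : set 'rV[R]_N) (u w : 'rV[R]_N -> R).
Hypotheses (mOmega : measurable Omega) (Hu : H0s s Omega u).
Hypotheses (mw : measurable_fun setT w) (wM : forall x, `|w x| <= M).
Hypothesis Ew : (energy s (fun x => (u x * w x)%R) < +oo)%E.

Let v t x := u x + t * (u x * w x).

Let mfu : measurable_fun setT u. Proof. by have /H0sP[] := Hu. Qed.

Let muw : measurable_fun setT (fun x => u x * w x).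
Proof. exact: measurable_funM. Qed.

Let mv t : measurable_fun setT (v t).
Proof. by apply: measurable_funD => //; exact: measurable_funM. Qed.

Lemma energy_two_sided t : (energy s (v t) + energy s (v (- t)) =
  2%:E * energy s u + 2%:E * ((t ^+ 2)%:E * energy s (fun x => (u x * w x)%R)))%E.
Proof.
have mtuw : measurable_fun setT (fun x => t * (u x * w x)) by exact: measurable_funM.
rewrite -(energyZ s t muw) -(energy_parallelogram s mfu mtuw).
have -> : v (- t) = (fun x => u x - t * (u x * w x)).
  by apply/funext => x; rewrite /v mulNr.
by [].
Qed.

Let E2_lty t : (energy s (v t) + energy s (v (- t)) < +oo)%E.
Proof.
have /H0sP[_ _ Eu _] := Hu.
have fin (a : R) (f : 'rV[R]_N -> R) : 0 <= a ->
    (energy s f < +oo)%E -> (a%:E * energy s f < +oo)%E.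
  by move=> a0 Ef; rewrite lte_mul_pinfty// lee_fin.
rewrite energy_two_sided muleA -EFinM; apply: lte_add_pinfty; apply: fin => //.
by rewrite mulr_ge0// sqr_ge0.
Qed.

Lemma energy_lty_perturb t : (energy s (v t) < +oo)%E.
Proof. by apply: le_lt_trans (E2_lty t); rewrite leeDl// energy_ge0. Qed.

Lemma fine_energy_two_sided t :
  fine (energy s (v t)) + fine (energy s (v (- t))) =
  2 * fine (energy s u) + 2 * t ^+ 2 * fine (energy s (fun x => u x * w x)).
Proof.
have /H0sP[_ _ Eu _] := Hu.
have fin (f : 'rV[R]_N -> R) : (energy s f < +oo)%E -> energy s f \is a fin_num.
  by move=> ?; rewrite ge0_fin_numE// energy_ge0.
rewrite -fineD ?fin ?energy_lty_perturb// energy_two_sided.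
rewrite -(fineK (fin _ Eu)) -(fineK (fin _ Ew)) -!EFinM -EFinD /=.
by rewrite mulrA.
Qed.

Lemma H0s_perturb t : H0s s Omega (v t).
Proof.
have /H0sP[_ u2 _ u0] := Hu.
apply/H0sP; split; [exact: mv| |exact: energy_lty_perturb|]; last first.
  move: u0; rewrite /ae_on; apply: filterS => x ux Ox.
  by rewrite /v (ux Ox) mul0r mulr0 addr0.
have b0 : 0 <= (1 + `|t| * `|M|) ^+ 2 by exact: sqr_ge0.
have mu2 : measurable_fun setT (fun x => (u x ^+ 2)%:E).
  by apply/measurable_EFinP; exact: measurable_funX.
apply: (@le_lt_trans _ _ (\int[mu]_x (((1 + `|t| * `|M|) ^+ 2)%:E * (u x ^+ 2)%:E))%E).
  apply: ge0_le_integral => //.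
  - by move=> x _; rewrite lee_fin sqr_ge0.
  - by apply/measurable_EFinP; exact: measurable_funX.
  - exact: measurable_funeM.
  - move=> x _; rewrite -EFinM lee_fin /v.
    have -> : u x + t * (u x * w x) = (1 + t * w x) * u x by ring.
    rewrite exprMn ler_wpM2r ?sqr_ge0// -[leLHS]real_normK ?num_real//.
    rewrite lerXn2r ?nnegrE ?addr_ge0 ?mulr_ge0//.
    apply: le_trans (ler_normD _ _) _; rewrite normr1 lerD2l normrM ler_wpM2l//.
    exact: le_trans (wM x) (ler_norm _).
rewrite ge0_integralZl_EFin//; first by rewrite lte_mul_pinfty// lee_fin.
by move=> x _; rewrite lee_fin sqr_ge0.
Qed.

Lemma perturbed_weight (h : 'rV[R]_N -> R) t :
  mu.-integrable Omega (EFin \o (fun x => h x * u x ^+ 2)) ->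
  \int[mu]_(x in Omega) (h x * v t x ^+ 2) =
  \int[mu]_(x in Omega) (h x * u x ^+ 2)
    + 2 * t * \int[mu]_(x in Omega) (h x * u x ^+ 2 * w x)
    + t ^+ 2 * \int[mu]_(x in Omega) (h x * u x ^+ 2 * w x * w x).
Proof.
move=> ih; rewrite -(Rintegral_quadratic mOmega t ih _ wM); last first.
  exact: measurable_funTS.
by apply: eq_Rintegral => x _; rewrite /v; ring.
Qed.

(** Both quotients are stationary at [u] in the direction [u * w], and the
    derivatives of the common energy cancel. To avoid the bilinear form of the
    energy, the first quotient is tested at [u + t * (u * w)] and the second one
    at [u - t * (u * w)]: by the parallelogram law the sum of the two energies
    has no term of order one in [t], so the inequality at small [t] forces the
    remaining coefficient of order one to vanish. *)
Lemma stationarity_exchange (g V g' V' : 'rV[R]_N -> R) (lam : R) :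
  mu.-integrable Omega (EFin \o (fun x => g x * u x ^+ 2)) ->
  mu.-integrable Omega (EFin \o (fun x => V x * u x ^+ 2)) ->
  mu.-integrable Omega (EFin \o (fun x => g' x * u x ^+ 2)) ->
  mu.-integrable Omega (EFin \o (fun x => V' x * u x ^+ 2)) ->
  0 < \int[mu]_(x in Omega) (g x * u x ^+ 2) ->
  0 < \int[mu]_(x in Omega) (g' x * u x ^+ 2) ->
  (forall f, admissible s Omega g f -> lam <= rayleigh s Omega g V f) ->
  (forall f, admissible s Omega g' f -> lam <= rayleigh s Omega g' V' f) ->
  rayleigh s Omega g V u <= lam -> rayleigh s Omega g' V' u <= lam ->
  \int[mu]_(x in Omega) (V x * u x ^+ 2 * w x)
    - lam * \int[mu]_(x in Omega) (g x * u x ^+ 2 * w x) =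
  \int[mu]_(x in Omega) (V' x * u x ^+ 2 * w x)
    - lam * \int[mu]_(x in Omega) (g' x * u x ^+ 2 * w x).
Proof.
move=> ig iV ig' iV' g0 g'0 Hg Hg'.
rewrite !rayleighE !ler_pdivrMr// => Ug Ug'.
have [t1 t10 P1] := quadratic_gt0_near
  (\int[mu]_(x in Omega) (g x * u x ^+ 2 * w x))
  (\int[mu]_(x in Omega) (g x * u x ^+ 2 * w x * w x)) g0.
have [t2 t20 P2] := quadratic_gt0_near
  (\int[mu]_(x in Omega) (g' x * u x ^+ 2 * w x))
  (\int[mu]_(x in Omega) (g' x * u x ^+ 2 * w x * w x)) g'0.
have num (G W : 'rV[R]_N -> R) t :
    mu.-integrable Omega (EFin \o (fun x => G x * u x ^+ 2)) ->
    mu.-integrable Omega (EFin \o (fun x => W x * u x ^+ 2)) ->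
    (forall f, admissible s Omega G f -> lam <= rayleigh s Omega G W f) ->
    0 < \int[mu]_(x in Omega) (G x * u x ^+ 2) +
      2 * t * \int[mu]_(x in Omega) (G x * u x ^+ 2 * w x) +
      t ^+ 2 * \int[mu]_(x in Omega) (G x * u x ^+ 2 * w x * w x) ->
    lam * (\int[mu]_(x in Omega) (G x * u x ^+ 2) +
      2 * t * \int[mu]_(x in Omega) (G x * u x ^+ 2 * w x) +
      t ^+ 2 * \int[mu]_(x in Omega) (G x * u x ^+ 2 * w x * w x)) <=
    fracC N s / 2 * fine (energy s (v t)) +
    (\int[mu]_(x in Omega) (W x * u x ^+ 2) +
      2 * t * \int[mu]_(x in Omega) (W x * u x ^+ 2 * w x) +
      t ^+ 2 * \int[mu]_(x in Omega) (W x * u x ^+ 2 * w x * w x)).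
  move=> iG iW HG; rewrite -!perturbed_weight// => den0.
  have /HG : admissible s Omega G (v t).
    by apply/admissibleE; split => //; exact: H0s_perturb.
  by rewrite rayleighE ler_pdivlMr.
apply/eqP; rewrite -subr_eq0; apply/eqP.
apply: (@linear_coef_eq0 _ _ (2 * (fracC N s / 2) * fine (energy s (fun x => u x * w x))
   + (\int[mu]_(x in Omega) (V x * u x ^+ 2 * w x * w x)
   + \int[mu]_(x in Omega) (V' x * u x ^+ 2 * w x * w x)
   - lam * (\int[mu]_(x in Omega) (g x * u x ^+ 2 * w x * w x)
   + \int[mu]_(x in Omega) (g' x * u x ^+ 2 * w x * w x)))) (Num.min t1 t2)).
  by rewrite lt_min t10.
move=> t; rewrite le_min => /andP[tt1 tt2].
have {}P1 := num g V t ig iV Hg (P1 t tt1).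
have tt2' : `|- t| <= t2 by rewrite normrN.
have {}P2 := num g' V' (- t) ig' iV' Hg' (P2 (- t) tt2').
exact: (second_difference_ge0 (fine_energy_two_sided t) P1 P2 Ug Ug').
Qed.

End test_direction.

End variation.

(** * Weights in the rearrangement classes *)

Section weights.
Context {R : realType} {N : nat}.
Local Notation mu := (@sf_lebesgue_rV R N).
Variables (Omega : set 'rV[R]_N).
Hypotheses (mOmega : measurable Omega) (Omega_fin : (mu Omega < +oo)%E).
Implicit Types (q A K : R) (f g h u V : 'rV[R]_N -> R).

Lemma rearrangement_integral f h (F : R -> R) : measurable_fun Omega f ->
  rearrangements Omega f h ->
  measurable_fun setT F -> (forall y, 0 <= F y) -> F 0 = 0 ->
  (\int[mu]_x (F ((h \_ Omega) x))%:E = \int[mu]_x (F ((f \_ Omega) x))%:E)%E.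
Proof.
move=> mf [mh fh] mF F0 F00.
apply: (equimeasurable_integral mOmega Omega_fin mf mh fh (F := EFin \o F)) => //.
- exact/measurable_EFinP.
- by rewrite /= F00.
Qed.

Lemma measurable_powR_norm q : measurable_fun setT (fun y : R => `|y| `^ q).
Proof. exact: (measurableT_comp (measurable_powR q) (@normr_measurable R setT)). Qed.

Lemma rearrangement_norm q f h : 0 < q -> measurable_fun Omega f ->
  rearrangements Omega f h -> norm_Lp Omega q%:E h = norm_Lp Omega q%:E f.
Proof.
move=> q0 mf fh; apply: eq_norm_Lp.
apply: (rearrangement_integral mf fh (F := fun y => `|y| `^ q)).
- exact: measurable_powR_norm.
- by move=> y; rewrite powR_ge0.
- by rewrite normr0 powR0// gt_eqF.
Qed.

Lemma rearrangement_norm_neg q f h : 0 < q -> measurable_fun Omega f ->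
  rearrangements Omega f h ->
  norm_Lp Omega q%:E (h^\-)%R = norm_Lp Omega q%:E (f^\-)%R.
Proof.
move=> q0 mf fh; apply: eq_norm_Lp.
have E (k : 'rV[R]_N -> R) x :
    `|((k^\-)%R \_ Omega) x| `^ q = `|Num.max (- (k \_ Omega) x) 0| `^ q.
  rewrite !patchE; case: ifP => // _.
  by rewrite /point /= oppr0 maxxx.
under eq_integral do rewrite E.
under [RHS]eq_integral do rewrite E.
apply: (rearrangement_integral mf fh (F := fun y => `|Num.max (- y) 0| `^ q)).
- apply: (measurableT_comp (measurable_powR_norm q)).
  by apply: measurable_maxr => //; exact: oppr_measurable.
- by move=> y; rewrite powR_ge0.
- by rewrite oppr0 maxxx normr0 powR0// gt_eqF.
Qed.

Lemma weight_integrable q h u : 1 < q ->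
  measurable_fun Omega h -> measurable_fun setT u ->
  (norm_Lp Omega q%:E h < +oo)%E ->
  (norm_Lp Omega (2 * conj_exp q)%:E u < +oo)%E ->
  mu.-integrable Omega (EFin \o (fun x => h x * u x ^+ 2)).
Proof.
move=> q1 mh mfu hq uq; have muO : measurable_fun Omega u by exact: measurable_funTS.
apply/integrableP; split.
  by apply/measurable_EFinP; apply: measurable_funM => //; exact: measurable_funX.
under eq_integral => x _ do rewrite /= -[u x ^+ 2]real_normK ?num_real//.
apply: le_lt_trans (hoelder_weight mOmega q1 mh muO) _.
apply: lte_mul_pinfty => //; first exact: Lnorm_ge0.
  by rewrite ge0_fin_numE//; exact: Lnorm_ge0.
exact: poweR_lty.
Qed.

(** Only the negative part of [V] can lower the integral, and Hoelder's
    inequality bounds its contribution. *)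
Lemma weight_ge q V u (K A : R) : 1 < q ->
  measurable_fun Omega V -> measurable_fun setT u ->
  (norm_Lp Omega q%:E (V^\-)%R <= K%:E)%E ->
  (norm_Lp Omega (2 * conj_exp q)%:E u <= A%:E)%E ->
  mu.-integrable Omega (EFin \o (fun x => V x * u x ^+ 2)) ->
  - (K * A ^+ 2) <= \int[mu]_(x in Omega) (V x * u x ^+ 2).
Proof.
move=> q1 mV mfu VK uA iV; have muO : measurable_fun Omega u by exact: measurable_funTS.
have mVn : measurable_fun Omega (V^\-)%R by exact: measurable_funrneg.
have K0 : 0 <= K by rewrite -lee_fin; apply: le_trans VK; exact: Lnorm_ge0.
have A0 : 0 <= A by rewrite -lee_fin; apply: le_trans uA; exact: Lnorm_ge0.
have iVn : mu.-integrable Omega (EFin \o (fun x => V^\- x * u x ^+ 2)).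
  apply: (weight_integrable q1) => //.
    by apply: le_lt_trans VK _; rewrite ltry.
  by apply: le_lt_trans uA _; rewrite ltry.
have Vn0 x : 0 <= (V^\-)%R x by rewrite /funrneg le_max lexx orbT.
apply: (@le_trans _ _ (\int[mu]_(x in Omega) (- 1 * (V^\- x * u x ^+ 2)))).
  rewrite RintegralZl// mulN1r lerN2 -lee_fin /Rintegral fineK; last first.
    exact: integrable_fin_num.
  apply: (@le_trans _ _ (norm_Lp Omega q%:E (V^\-)%R *
      norm_Lp Omega (2 * conj_exp q)%:E u `^ 2)%E).
    apply: le_trans (hoelder_weight mOmega q1 mVn muO).
    rewrite le_eqVlt; apply/orP; left; apply/eqP; apply: eq_integral => x _.
    by rewrite ger0_norm ?mulr_ge0 ?exprn_ge0// real_normK ?num_real.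
  have u2A : (norm_Lp Omega (2 * conj_exp q)%:E u `^ 2 <= (A ^+ 2)%:E)%E.
    rewrite -powR_mulrn// -poweR_EFin.
    by apply: gt0_ler_poweR => //; rewrite in_itv/= leey andbT ?lee_fin//; exact: Lnorm_ge0.
  by rewrite (EFinM K); apply: lee_pmul => //; [exact: Lnorm_ge0|exact: poweR_ge0].
apply: le_Rintegral => //; first exact: (integrableZl mOmega (-1) iVn).
move=> x _; rewrite mulN1r -mulNr ler_wpM2r ?sqr_ge0//.
by rewrite lerNl /funrneg le_max lexx.
Qed.

Lemma weight_eq0 q g u : 1 < q ->
  measurable_fun Omega g -> measurable_fun setT u ->
  (norm_Lp Omega q%:E g < +oo)%E ->
  norm_Lp Omega (2 * conj_exp q)%:E u = 0%E ->
  \int[mu]_(x in Omega) (g x * u x ^+ 2) = 0.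
Proof.
move=> q1 mg mfu gq u0; have muO : measurable_fun Omega u by exact: measurable_funTS.
have ig : mu.-integrable Omega (EFin \o (fun x => g x * u x ^+ 2)).
  by apply: (weight_integrable q1) => //; rewrite u0.
have := hoelder_weight mOmega q1 mg muO.
rewrite u0 poweR0r// mule0 => H.
apply/eqP; rewrite -normr_le0; apply: le_trans (le_normr_Rintegral mOmega ig) _.
rewrite /Rintegral -lee_fin fineK; last first.
  apply: integrable_fin_num => //; exact: (integrable_norm ig).
apply: le_trans H; rewrite le_eqVlt; apply/orP; left; apply/eqP.
by apply: eq_integral => x _; rewrite real_normK ?num_real.
Qed.

End weights.

(** * Exchanges that detect a failure of monotonicity *)

Section improving_swap.
Context {R : realType} {n : nat}.
Local Notation N := n.+1.
Local Notation mu := (@sf_lebesgue_rV R N).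
Implicit Types (Omega D : set 'rV[R]_N) (g G u V w : 'rV[R]_N -> R).

Lemma first_coordE (x : 'rV[R]_N) : first_coord x = x ord0 ord0.
Proof. by rewrite /first_coord (big_pred1 ord0). Qed.

Lemma cos_first_coord_level_null (k : R) :
  mu [set x | cos (first_coord x) = k] = 0%E.
Proof.
rewrite -(@lebesgue_rV_coord0 R n [set t | cos t = k]).
- by congr (sf_lebesgue_rV _ _); apply/seteqP; split => x /=; rewrite first_coordE.
- have mcos : measurable_fun setT (@cos R).
    by apply: continuous_measurable_fun; exact: continuous_cos.
  by rewrite -[X in measurable X]setTI; exact: (mcos measurableT [set k]).
- exact: cos_level_null.
Qed.

Definition rearranging_involution Omega (T : 'rV[R]_N -> 'rV[R]_N) :=
  [/\ measurable_fun setT T, forall A, measurable A -> mu (T @^-1` A) = mu A,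
      involutive T & forall x, Omega (T x) <-> Omega x].

(** Exchanging a piece of [Omega] where [u] is small and [G] large with a
    translate where [u] is large and [G] small moves [G] towards the order of
    [u]. Choosing the two pieces on opposite sides of a level of the cosine of
    the first coordinate makes [cos_weight] detect the exchange even if [u] is
    constant on them. *)
Lemma improving_swap Omega G u (c t : R) :
  measurable Omega -> measurable_fun Omega G -> measurable_fun setT u ->
  {ae mu, forall x, Omega x -> 0 < u x} ->
  ~ mu.-negligible (Omega `&` [set x | u x <= t /\ c < G x]) ->
  ~ mu.-negligible (Omega `&` [set x | t <= u x /\ G x < c]) ->
  exists (e k : R) (T : 'rV[R]_N -> 'rV[R]_N),
  [/\ rearranging_involution Omega T,
      forall x, Omega x -> 0 <= (G (T x) - G x) * (u x ^+ 2 - u (T x) ^+ 2),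
      forall x, Omega x ->
        0 <= (G x - G (T x)) * u x ^+ 2 * cos_weight e k x &
      ~ mu.-negligible (Omega `&` [set x |
        (G x - G (T x)) * u x ^+ 2 * cos_weight e k x != 0])].
Proof.
move=> mO mG mfu upos nA nB.
have muO : measurable_fun Omega u by exact: measurable_funTS.
pose A := Omega `&` [set x | 0 < u x /\ u x <= t /\ c < G x].
pose B := Omega `&` [set x | t <= u x /\ G x < c].
have mray (f : 'rV[R]_N -> R) (I : interval R) : measurable_fun Omega f ->
    measurable (Omega `&` f @^-1` [set` I]).
  by move=> mf; apply: mf => //; exact: measurable_itv.
have mA : measurable A.
  rewrite (_ : A = (Omega `&` u @^-1` `]0, t]) `&` (Omega `&` G @^-1` `]c, +oo[)).
    by apply: measurableI; exact: mray.
  apply/seteqP; split => x /=; rewrite !in_itv/= andbT.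
    by move=> [Ox [-> [-> ->]]].
  by move=> [[Ox /andP[? ?]] [_ ?]].
have mB : measurable B.
  rewrite (_ : B = (Omega `&` u @^-1` `[t, +oo[) `&` (Omega `&` G @^-1` `]-oo, c[)).
    by apply: measurableI; exact: mray.
  apply/seteqP; split => x /=; rewrite !in_itv/= andbT.
    by move=> [Ox [-> ->]].
  by move=> [[Ox ?] [_ ?]].
have A0 : (0 < mu A)%E.
  rewrite lt0e measure_ge0 andbT; apply/eqP => A0; apply: nA.
  have An : mu.-negligible A by exists A; split.
  apply: (negligibleS _ (negligibleU An upos)) => x [Ox [ut cG]].
  have [u0|u0] := pselect (0 < u x); first by left.
  by right => /(_ Ox).
have B0 : (0 < mu B)%E.
  rewrite lt0e measure_ge0 andbT; apply/eqP => B0; apply: nB.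
  by exists B; split.
have [e [k []]] := separating_threshold measurable_cos_first_coord
  cos_first_coord_level_null mA mB A0 B0.
set A1 := A `&` _; set B1 := B `&` _ => A10 B10.
have mw := @measurable_cos_weight R N e k.
have mA1 : measurable A1.
  apply: measurableI => //.
  rewrite (_ : mkset _ = cos_weight e k @^-1` `]0, +oo[).
    by rewrite -[X in measurable X]setTI; apply: mw => //; exact: measurable_itv.
  by apply/seteqP; split => x /=; rewrite in_itv/= andbT.
have mB1 : measurable B1.
  apply: measurableI => //.
  rewrite (_ : mkset _ = cos_weight e k @^-1` `]-oo, 0[).
    by rewrite -[X in measurable X]setTI; apply: mw => //; exact: measurable_itv.
  by apply/seteqP; split => x /=; rewrite in_itv/=.
have [a D0] := translate_meets mA1 mB1 A10 B10.
set D := [set x | _] in D0.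
have mD : measurable D by apply: measurableI => //; exact: measurable_shift.
have DE x : D x -> [/\ Omega x /\ Omega (x + a), 0 < u x <= u (x + a),
    G (x + a) < G x & cos_weight e k (x + a) < 0 < cos_weight e k x].
  move=> [[[Ox [u0 [ut cG]]] /= w0] [[Oxa [tu Gc]] /= wa0]]; split => //.
  - by rewrite u0 (le_trans ut tu).
  - exact: lt_trans Gc cG.
  - by rewrite /cos_weight w0 wa0.
have Da x : D x -> ~ D (x + a).
  move=> /DE[_ _ _ /andP[w0 _]] /DE[_ _ _ /andP[_ w1]].
  by have := lt_trans w0 w1; rewrite ltxx.
have swapD x : D x -> swap D a x = x + a.
  by move=> xD; rewrite /swap (@mem_set _ D).
have swapDa x : D (x - a) -> swap D a x = x - a.
  move=> xD; rewrite /swap (@memNset _ D) ?(@mem_set _ D)//.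
  by have := Da _ xD; rewrite subrK.
have swapN x : ~ D x -> ~ D (x - a) -> swap D a x = x.
  by move=> xD xaD; rewrite /swap !(@memNset _ D).
(* A point is in [D], in the translate of [D], or fixed. *)
have cases (P : 'rV[R]_N -> Prop) :
    (forall x, D x -> P x /\ P (x + a)) ->
    (forall x, swap D a x = x -> P x) -> forall x, P x.
  move=> PD PN x; have [xD|xD] := pselect (D x); first exact: (PD _ xD).1.
  have [xaD|xaD] := pselect (D (x - a)); last by apply: PN; exact: swapN.
  by have := (PD _ xaD).2; rewrite subrK.
have swapDD x : D x -> swap D a (x + a) = x.
  by move=> xD; rewrite swapDa addrK.
exists e, k, (swap D a); split; first split.
- exact: measurable_swap.
- by move=> S mS; exact: swap_preserving.
- exact: swapK.
- apply: cases => [x xD|x ->//].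
  by have [[Ox Oxa] _ _ _] := DE _ xD; rewrite swapD// swapDD.
- apply: cases => [x xD|x -> _]; last by rewrite subrr mul0r.
  have [_ /andP[u0 uu] GG _] := DE _ xD; rewrite swapD// swapDD//.
  have uu2 : u x ^+ 2 <= u (x + a) ^+ 2.
    by rewrite ler_sqr// nnegrE ?ltW// (lt_le_trans u0 uu).
  split=> _; last by rewrite mulr_ge0 ?subr_ge0// ltW.
  by rewrite mulr_le0// subr_le0// ltW.
- apply: cases => [x xD|x -> _]; last by rewrite subrr !mul0r.
  have [_ _ GG /andP[w0 w1]] := DE _ xD; rewrite swapD// swapDD//.
  have u0 y : 0 <= u y ^+ 2 by exact: sqr_ge0.
  split=> _; last by rewrite mulr_le0 ?(ltW w0)// mulr_le0_ge0// subr_le0 ltW.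
  apply: mulr_ge0; last exact: ltW.
  by apply: mulr_ge0 => //; rewrite subr_ge0 ltW.
move=> neg; have : mu.-negligible D.
  apply: negligibleS neg => x xD; have [[Ox _] /andP[u0 _] GG /andP[_ w1]] := DE _ xD.
  split => //=; rewrite swapD//; apply: mulf_neq0; last by rewrite gt_eqF.
  by apply: mulf_neq0; [rewrite subr_eq0 gt_eqF|rewrite expf_neq0 ?gt_eqF].
by move=> /(measure_negligible mD) D00; move: D0; rewrite D00 ltxx.
Qed.

Lemma negligible_of_integral0 Omega (F : 'rV[R]_N -> R) :
  measurable Omega -> mu.-integrable Omega (EFin \o F) ->
  (forall x, Omega x -> 0 <= F x) -> \int[mu]_(x in Omega) F x = 0 ->
  mu.-negligible (Omega `&` [set x | F x != 0]).
Proof.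
move=> mO iF F0 F00; have /integrableP[mF _] := iF.
have /(ae_eq_integral_abs mu mO mF) : (\int[mu]_(x in Omega) `|(EFin \o F) x| = 0)%E.
  rewrite -[RHS]/(0%:E) -F00 /Rintegral fineK; last exact: integrable_fin_num.
  by apply: eq_integral => x /set_mem Ox; rewrite /= ger0_norm// F0.
apply: negligibleS => x [Ox /= Fx] /(_ Ox) [F0x].
by move: Fx; rewrite F0x eqxx.
Qed.

(** The last hypothesis is what optimality of [G] provides through
    [stationarity_exchange]; for the involution of [improving_swap]
    it forces an integrand that is nonnegative, but not almost everywhere zero,
    to have integral zero. *)
Lemma similarly_ordered Omega G u :
  measurable Omega -> measurable_fun Omega G -> measurable_fun setT u ->
  {ae mu, forall x, Omega x -> 0 < u x} ->
  (forall T, rearranging_involution Omega T ->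
     mu.-integrable Omega (EFin \o (fun x => G (T x) * u x ^+ 2))) ->
  (forall T (e k : R), rearranging_involution Omega T ->
     \int[mu]_(x in Omega) (G x * u x ^+ 2) <=
       \int[mu]_(x in Omega) (G (T x) * u x ^+ 2) ->
     \int[mu]_(x in Omega) (G x * u x ^+ 2 * cos_weight e k x) =
       \int[mu]_(x in Omega) (G (T x) * u x ^+ 2 * cos_weight e k x)) ->
  forall c t, mu.-negligible (Omega `&` [set x | u x <= t /\ c < G x]) \/
              mu.-negligible (Omega `&` [set x | t <= u x /\ G x < c]).
Proof.
move=> mO mG mfu upos iG H c t.
have [|nA] := pselect (mu.-negligible (Omega `&` [set x | u x <= t /\ c < G x])).
  by left.
right; apply: contrapT => nB.
have [e [k [T [RT dG dw]]]] := improving_swap mO mG mfu upos nA nB; apply.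
have [mT T_mu TK TO] := RT.
have id_inv : rearranging_involution Omega id by split.
have i1 := iG _ id_inv; have i2 := iG _ RT.
have mw : measurable_fun Omega (cos_weight e k).
  by apply: measurable_funTS; exact: measurable_cos_weight.
have wM := @cos_weight_le R N e k.
have i1w := integrable_mul_bounded mO i1 mw wM.
have i2w := integrable_mul_bounded mO i2 mw wM.
have iGT := involution_integral_le mT T_mu mO TO TK i1 i2 dG.
have E : (fun x => (G x - G (T x)) * u x ^+ 2 * cos_weight e k x) =
    (fun x => G x * u x ^+ 2 * cos_weight e k x -
              G (T x) * u x ^+ 2 * cos_weight e k x).
  by apply/funext => x; ring.
apply: negligible_of_integral0 => //.
  by rewrite E; exact: (integrableB mO i1w i2w).
by rewrite E RintegralB// (H T e k RT iGT) subrr.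
Qed.

End improving_swap.

(** * Minimal pairs *)

Section minimal_pair.
Context {R : realType} {n : nat}.
Local Notation N := n.+1.
Local Notation mu := (@sf_lebesgue_rV R N).
Implicit Types (g h V v w : 'rV[R]_N -> R).

Lemma rearrangement_comp (Omega : set 'rV[R]_N) f h T :
  measurable Omega -> rearranging_involution Omega T ->
  rearrangements Omega f h -> rearrangements Omega f (h \o T).
Proof.
move=> mO [mT T_mu _ TO] [mh fh].
have E (Y : set R) : Omega `&` (h \o T) @^-1` Y = T @^-1` (Omega `&` h @^-1` Y).
  by apply/seteqP; split => x /=; rewrite TO.
split.
  move=> _ Y mY; rewrite E -[X in measurable X]setTI; apply: mT => //.
  exact: mh.
move=> t; rewrite -fh.
have -> : [set x | t < (h \o T) x] = (h \o T) @^-1` [set y | t < y] by [].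
rewrite E; apply: T_mu.
have -> : [set y | t < y] = `]t, +oo[%classic.
  by apply/seteqP; split => y /=; rewrite in_itv/= andbT.
by apply: mh => //; exact: measurable_itv.
Qed.

(** For an infinite integral, [fine] would be [0] and so would its inverse. *)
Lemma fracC_kernel_lty (s : R) : 0 < fracC N s ->
  (\int[mu]_z ((1 - cos (first_coord z)) * riesz s z)%:E < +oo)%E.
Proof.
have -> : fracC N s =
    (fine (\int[mu]_z ((1 - cos (first_coord z)) * riesz s z)%:E))^-1 by [].
set I := integral _ _ _; have I0 : (0 <= I)%E.
  apply: integral_ge0 => z _.
  by rewrite lee_fin mulr_ge0 ?riesz_ge0// subr_ge0 cos_le1.
by case: I I0 => [r|_|//]; rewrite ?ltry// invr0 ltxx.
Qed.

Lemma energy_cos_weight_lty (s : R) (Omega : set 'rV[R]_N) u (e k : R) :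
  0 < fracC N s -> H0s s Omega u ->
  (energy s (fun x => (u x * cos_weight e k x)%R) < +oo)%E.
Proof.
move=> c0 /H0sP[mfu u2 Eu _]; have I_lty := fracC_kernel_lty c0.
have I0 : (0 <= \int[mu]_z ((1 - cos (first_coord z)) * riesz s z)%:E)%E.
  apply: integral_ge0 => z _.
  by rewrite lee_fin mulr_ge0 ?riesz_ge0// subr_ge0 cos_le1.
have e2 : 0 <= 2 * e ^+ 2 by rewrite mulr_ge0// sqr_ge0.
set J : \bar R := ((2 * e ^+ 2)%:E *
  \int[mu]_z ((1 - cos (first_coord z)) * riesz s z)%:E)%E.
have J0 : (0 <= J)%E by rewrite mule_ge0// lee_fin.
have J_lty : (J < +oo)%E by rewrite lte_mul_pinfty// lee_fin.
have u20 : (0 <= \int[mu]_x (u x ^+ 2)%:E)%E.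
  by apply: integral_ge0 => x _; rewrite lee_fin sqr_ge0.
apply: le_lt_trans (energy_mul_le mfu (measurable_cos_weight e k)
  (@cos_weight_le R N e k) J0 (cos_weight_quotient s e k)) _.
apply: lte_add_pinfty.
  by rewrite lte_mul_pinfty// lee_fin mulr_ge0// sqr_ge0.
rewrite lte_mul_pinfty// ?lee_fin//.
by rewrite lte_mul_pinfty// ge0_fin_numE.
Qed.

Variables (s q C delta : R) (Omega : set 'rV[R]_N).
Variables g0 V0 gl Vl u : 'rV[R]_N -> R.
Hypotheses (mOmega : measurable Omega) (Omega_fin : (mu Omega < +oo)%E).
Hypotheses (q1 : 1 < q) (hC : embedding_bound s q Omega C).
Hypotheses (hg0 : in_Lp Omega q%:E g0) (hV0 : in_Lp Omega q%:E V0).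
Hypotheses (delta0 : 0 < delta) (delta1 : delta < fracC N s / 2).
Hypothesis hV0neg : (norm_Lp Omega q%:E (V0^\-)%R
  <= ((fracC N s / 2 - delta) / C ^+ 2)%:E)%E.
Hypotheses (hgl : rearrangements Omega g0 gl) (hVl : rearrangements Omega V0 Vl).
Hypothesis hmin : forall g V,
  rearrangements Omega g0 g -> rearrangements Omega V0 V ->
  (lambda1 s Omega gl Vl <= lambda1 s Omega g V)%E.
Hypothesis hu : first_eigenfunction s Omega gl Vl u.
Hypothesis hupos : {ae mu, forall x, Omega x -> 0 < u x}.

Let lam := rayleigh s Omega gl Vl u.

Let q0 : 0 < q. Proof. exact: lt_trans q1. Qed.

Let fracC_gt0 : 0 < fracC N s.
Proof. by move: delta0 delta1; lra. Qed.

Let Hu : H0s s Omega u. Proof. by case: hu => -[]. Qed.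

Let mfu : measurable_fun setT u. Proof. by have /H0sP[] := Hu. Qed.

Let gag_fin : gagliardo s u \is a fin_num.
Proof.
have /H0sP[_ _ /gagliardo_lty] := Hu.
by rewrite ge0_fin_numE// poweR_ge0.
Qed.

Let u_norm_le : (norm_Lp Omega (2 * conj_exp q)%:E u <=
  (C * fine (gagliardo s u))%:E)%E.
Proof. by rewrite (EFinM C) fineK//; exact: hC. Qed.

Let u_norm_lty : (norm_Lp Omega (2 * conj_exp q)%:E u < +oo)%E.
Proof. by apply: le_lt_trans u_norm_le _; rewrite ltry. Qed.

Let rearranged_weight h0 h : in_Lp Omega q%:E h0 -> rearrangements Omega h0 h ->
  mu.-integrable Omega (EFin \o (fun x => h x * u x ^+ 2)).
Proof.
move=> [mh0 h0q] hh; have [mh _] := hh.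
apply: (weight_integrable mOmega q1 mh mfu _ u_norm_lty).
by rewrite (rearrangement_norm mOmega Omega_fin q0 mh0 hh).
Qed.

Let den_gt0 : 0 < \int[mu]_(x in Omega) (gl x * u x ^+ 2).
Proof. by case: hu => /admissibleE[]. Qed.

Let lam_le g V v : rearrangements Omega g0 g -> rearrangements Omega V0 V ->
  admissible s Omega g v -> lam <= rayleigh s Omega g V v.
Proof.
move=> gE VE adm; rewrite -lee_fin; case: hu => _ ->.
apply: le_trans (hmin gE VE) _.
by apply: ereal_inf_lbound; exists v.
Qed.

(** With [G] the Gagliardo seminorm of [u], the potential contributes at least
    [- (fracC N s / 2 - delta) / C ^ 2 * (C * G) ^ 2], which leaves
    [delta * G ^ 2]. Here [C] and [G] are positive because otherwise the
    embedding would make [u] vanish on [Omega], contradicting [den_gt0]. *)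
Let num_gt0 : 0 < fracC N s / 2 * fine (energy s u) +
  \int[mu]_(x in Omega) (Vl x * u x ^+ 2).
Proof.
have [mVl _] := hVl; have [mgl _] := hgl.
set G := fine (gagliardo s u).
have G0 : 0 <= G by apply: fine_ge0; exact: poweR_ge0.
have CG : 0 < C * G.
  rewrite lt_neqAle -lee_fin (le_trans _ u_norm_le) ?andbT; last exact: Lnorm_ge0.
  apply/eqP => CG0; move: den_gt0; rewrite (weight_eq0 mOmega q1 mgl mfu) ?ltxx//.
    by rewrite (rearrangement_norm mOmega Omega_fin q0 hg0.1 hgl); exact: hg0.2.
  apply/eqP; rewrite eq_le; apply/andP; split; last exact: Lnorm_ge0.
  by apply: le_trans u_norm_le _; rewrite lee_fin -/G -CG0.
have G_gt0 : 0 < G by rewrite lt0r G0 andbT; apply: contraTneq CG => ->; rewrite mulr0 ltxx.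
have C_gt0 : 0 < C by rewrite -(pmulr_lgt0 _ G_gt0).
have Vneg : (norm_Lp Omega q%:E (Vl^\-)%R <= ((fracC N s / 2 - delta) / C ^+ 2)%:E)%E.
  by rewrite (rearrangement_norm_neg mOmega Omega_fin q0 hV0.1 hVl).
have := weight_ge mOmega q1 mVl mfu Vneg u_norm_le (rearranged_weight hV0 hVl).
have -> : (fracC N s / 2 - delta) / C ^+ 2 * (C * G) ^+ 2 =
    (fracC N s / 2 - delta) * G ^+ 2 by field; rewrite gt_eqF.
rewrite -sqr_fine_gagliardo -/G.
have : 0 < delta * G ^+ 2 by rewrite mulr_gt0// exprn_gt0.
lra.
Qed.

Let lam_gt0 : 0 < lam.
Proof. by rewrite /lam rayleighE divr_gt0. Qed.

Lemma minimal_weight_ordered c t :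
  mu.-negligible (Omega `&` [set x | u x <= t /\ c < gl x]) \/
  mu.-negligible (Omega `&` [set x | t <= u x /\ gl x < c]).
Proof.
have [mgl _] := hgl.
apply: (similarly_ordered mOmega mgl mfu hupos) => [T RT|T e k RT le].
  exact: rearranged_weight hg0 (rearrangement_comp mOmega RT hgl).
have hgT := rearrangement_comp mOmega RT hgl.
have den'_gt0 := lt_le_trans den_gt0 le.
have mw := @measurable_cos_weight R N e k.
have := stationarity_exchange mOmega Hu mw (@cos_weight_le R N e k)
  (energy_cos_weight_lty e k fracC_gt0 Hu)
  (rearranged_weight hg0 hgl) (rearranged_weight hV0 hVl)
  (rearranged_weight hg0 hgT) (rearranged_weight hV0 hVl) den_gt0 den'_gt0
  (fun f => lam_le hgl hVl) (fun f => lam_le hgT hVl) (lexx lam).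
have : rayleigh s Omega (gl \o T) Vl u <= lam.
  rewrite /lam !rayleighE ler_pM2l//.
  by rewrite lef_pV2.
by move=> ray /(_ ray) /addrI /oppr_inj /(mulfI (lt0r_neq0 lam_gt0)).
Qed.

Lemma minimal_potential_ordered c t :
  mu.-negligible (Omega `&` [set x | u x <= t /\ c < - Vl x]) \/
  mu.-negligible (Omega `&` [set x | t <= u x /\ - Vl x < c]).
Proof.
have [mVl _] := hVl.
have mVN : measurable_fun Omega (\- Vl) by exact: measurable_funN.
have iN h : mu.-integrable Omega (EFin \o (fun x => h x * u x ^+ 2)) ->
    mu.-integrable Omega (EFin \o (fun x => - h x * u x ^+ 2)).
  move=> ih; rewrite (_ : _ \o _ = -%E \o (EFin \o (fun x => h x * u x ^+ 2))).
    exact: integrableN.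
  by apply/funext => x /=; rewrite mulNr.
have RN h w : mu.-integrable Omega (EFin \o (fun x => h x * w x)) ->
    \int[mu]_(x in Omega) (- h x * w x) = - \int[mu]_(x in Omega) (h x * w x).
  move=> ih; rewrite -mulN1r -RintegralZl//.
  by apply: eq_Rintegral => x _; rewrite mulN1r mulNr.
apply: (similarly_ordered mOmega mVN mfu hupos) => [T RT|T e k RT].
  exact: iN (rearranged_weight hV0 (rearrangement_comp mOmega RT hVl)).
have hVT := rearrangement_comp mOmega RT hVl.
have iV := rearranged_weight hV0 hVl; have iVT := rearranged_weight hV0 hVT.
rewrite !RN// lerN2 => le.
have mw := @measurable_cos_weight R N e k.
have := stationarity_exchange mOmega Hu mw (@cos_weight_le R N e k)
  (energy_cos_weight_lty e k fracC_gt0 Hu)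
  (rearranged_weight hg0 hgl) iV (rearranged_weight hg0 hgl) iVT den_gt0 den_gt0
  (fun f => lam_le hgl hVl) (fun f => lam_le hgl hVT) (lexx lam).
have : rayleigh s Omega gl (Vl \o T) u <= lam.
  by rewrite /lam !rayleighE ler_pM2r ?invr_gt0// lerD2l.
move=> ray /(_ ray) /addIr E.
have mwO : measurable_fun Omega (cos_weight e k) by exact: measurable_funTS.
have wM := @cos_weight_le R N e k.
have iVw := integrable_mul_bounded mOmega iV mwO wM.
have iVTw := integrable_mul_bounded mOmega iVT mwO wM.
transitivity (- \int[mu]_(x in Omega) (Vl x * u x ^+ 2 * cos_weight e k x)).
  rewrite -mulN1r -RintegralZl//.
  by apply: eq_Rintegral => x _; rewrite /=; ring.
rewrite E -mulN1r -RintegralZl//.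
by apply: eq_Rintegral => x _; rewrite /=; ring.
Qed.

End minimal_pair.

Section essential_bounds.
Context {R : realType} {N : nat}.
Local Notation mu := (@sf_lebesgue_rV R N).

(** If the whole space is null, the norm is [0] by convention and any bound is
    valid. *)
Lemma in_Lp_ae_bounded (Omega : set 'rV[R]_N) f : in_Lp Omega +oo%E f ->
  exists M : R, {ae mu, forall x, Omega x -> `|f x| <= M}.
Proof.
move=> [_]; rewrite /norm_Lp unlock; case: ifPn => [_|].
  set S := ess_sup _ _ => S_lty.
  have aeS : {ae mu, forall x, (`|((f \_ Omega) x)%:E| <= S)%E} by exact: ess_sup_ge.
  exists (fine S); apply: filterS aeS => x + Ox.
  rewrite patchE mem_set//; case: S S_lty => // r _ /=; by rewrite lee_fin.
rewrite -leNgt measure_le0 => /eqP mu0 _; exists 0.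
apply: (@negligibleS _ _ _ mu setT) => //.
by exists setT; split.
Qed.

Lemma rearrangement_essential_bound (Omega : set 'rV[R]_N) f h :
  measurable Omega -> (mu Omega < +oo)%E -> measurable_fun Omega f ->
  rearrangements Omega f h ->
  exists M : \bar R, [/\ (0 <= M)%E, in_Lp Omega +oo%E f -> M \is a fin_num &
    {ae mu, forall x, Omega x -> (- M <= (h x)%:E <= M)%E}].
Proof.
move=> mO Ofin mf [mh fh].
have [fb|fnb] := pselect (in_Lp Omega +oo%E f); last first.
  by exists +oo%E; split => //; apply: aeW => x _; rewrite leNye leey.
have [M fM] := in_Lp_ae_bounded fb.
pose Y : set (measurableTypeR R) := [set` `[- `|M|, `|M| ]].
have YE y : Y y <-> `|y| <= `|M| by rewrite /Y /= in_itv/= ler_norml.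
exists (`|M|%:E); split => //.
have : {ae mu, forall x, Omega x -> Y (h x)}.
  apply: (equimeasurable_ae mO Ofin mf mh fh); first exact: measurable_itv.
  apply: filterS fM => x H Ox; apply/YE; exact: le_trans (H Ox) (ler_norm _).
apply: filterS => x H Ox; rewrite -EFinN !lee_fin -ler_norml.
exact/YE/H.
Qed.

End essential_bounds.

Theorem proposition3p3 (R : realType) (N : nat) (hN : (2 <= N)%N)
  (s : R) (hs0 : 0 < s) (hs1 : s < 1)
  (Omega : set 'rV[R]_N) (hOmega : smooth_bounded_domain Omega)
  (q : R) (hq : N%:R / (2 * s) < q)
  (C : R) (hC : best_embedding_constant s q Omega C)
  (g0 V0 : 'rV[R]_N -> R)
  (hg0 : in_Lp Omega q%:E g0) (hV0 : in_Lp Omega q%:E V0)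
  (hg0pos : ~ ae_on Omega (fun x => (g0^\+)%R x = 0))
  (delta : R) (hdelta0 : 0 < delta) (hdelta1 : delta < fracC N s / 2)
  (hV0neg : (norm_Lp Omega q%:E (V0^\-)%R
               <= ((fracC N s / 2 - delta) / C ^+ 2)%:E)%E)
  (gl Vl : 'rV[R]_N -> R)
  (hgl : rearrangements Omega g0 gl) (hVl : rearrangements Omega V0 Vl)
  (hmin : forall g V, rearrangements Omega g0 g -> rearrangements Omega V0 V ->
     (lambda1 s Omega gl Vl <= lambda1 s Omega g V)%E)
  (u : 'rV[R]_N -> R) (hu : first_eigenfunction s Omega gl Vl u)
  (hupos : ae_on Omega (fun x => 0 < u x)) :
  (exists phi : R -> \bar R,
     [/\ nondecreasing_fun phi,
         in_Lp Omega +oo%E g0 -> forall t, phi t \is a fin_num &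
         ae_on Omega (fun x => (gl x)%:E = phi (u x))]) /\
  (exists psi : R -> \bar R,
     [/\ nonincreasing_fun psi,
         in_Lp Omega +oo%E V0 -> forall t, psi t \is a fin_num &
         ae_on Omega (fun x => (Vl x)%:E = psi (u x))]).
Proof.
have q1 : 1 < q.
  apply: lt_trans hq; rewrite ltr_pdivlMr ?mulr_gt0// mul1r.
  apply: (@lt_le_trans _ _ 2); first lra.
  by rewrite ler_nat.
have [oO _ _ bO _] := hOmega.
have mO := open_measurable_rV oO.
have Ofin := bounded_lebesgue_rV_lty bO mO.
destruct N as [|n]; first by [].
have upos : {ae @sf_lebesgue_rV R n.+1, forall x, Omega x -> 0 < u x} by exact: hupos.
have g_ord := minimal_weight_ordered mO Ofin q1 hC.1 hg0 hV0 hdelta0 hdelta1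
  hV0neg hgl hVl hmin hu upos.
have V_ord := minimal_potential_ordered mO Ofin q1 hC.1 hg0 hV0 hdelta0 hdelta1
  hgl hVl hmin hu upos.
have between (M : \bar R) (phi : R -> \bar R) : M \is a fin_num ->
    (forall t, (- M <= phi t <= M)%E) -> forall t, phi t \is a fin_num.
  move=> Mfin phiM t; move: (phiM t); rewrite -(fineK Mfin).
  by case: (phi t) => [r| |] //= /andP[].
split.
  have [M [M0 Mfin gM]] := rearrangement_essential_bound mO Ofin hg0.1 hgl.
  have MM : (- M <= M)%E by apply: (le_trans _ M0); rewrite oppe_le0.
  have [phi [phi_nd phiM phiE]] := ae_nondecreasing_factor g_ord MM gM.
  exists phi; split => //.
  by move=> /Mfin Mf; exact: between Mf phiM.
have [M [M0 Mfin VM]] := rearrangement_essential_bound mO Ofin hV0.1 hVl.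
have MM : (- M <= M)%E by apply: (le_trans _ M0); rewrite oppe_le0.
have VM' : {ae @sf_lebesgue_rV R n.+1, forall x, Omega x -> (- M <= (- Vl x)%:E <= M)%E}.
  by apply: filterS VM => x H Ox; rewrite EFinN leeN2 leeNl andbC; exact: H.
have [phi [phi_nd phiM phiE]] := ae_nondecreasing_factor V_ord MM VM'.
exists (fun t => - phi t)%E; split.
- by move=> t t' tt' /=; rewrite leeN2; exact: phi_nd.
- by move=> /Mfin Mf t; rewrite fin_numN; exact: between Mf phiM t.
- have E : {ae @sf_lebesgue_rV R n.+1, forall x, Omega x -> (Vl x)%:E = (- phi (u x))%E}.
    by apply: filterS phiE => x H Ox; rewrite -H// EFinN oppeK.
  exact: E.
Qed.
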